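(* Let $\mathbf{L}\in Q^2(\mathbb{D}^2)$. An analytic function $F\colon\mathbb{D}^2\to\mathbb{C}$ has bounded $\mathbf{L}$-index in joint variables if and only if there exist $R=(r_1,r_2)\in(0,\beta]^2$, $n_0\in\mathbb{Z}_+$ and $p_0>1$ such that for each $z^0\in\mathbb{D}^2$ there is $(k_1^0,k_2^0)\in\mathbb{Z}_+^2$ with $k_1^0+k_2^0\le n_0$ and $$\max\left\{\frac{|F^{(k_1,k_2)}(z)|}{k_1!k_2!\,l_1^{k_1}(z)l_2^{k_2}(z)}: k_1+k_2\le n_0,\ z\in\mathbb{D}^2\Big[z^0,\frac{R}{\mathbf{L}(z^0)}\Big]\right\}\le \frac{p_0}{k_1^0!k_2^0!}\,\frac{|F^{(k_1^0,k_2^0)}(z^0)|}{l_1^{k_1^0}(z^0)\,l_2^{k_2^0}(z^0)}.$$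
   Context: $\mathbb{D}^2=\{(z_1,z_2)\in\mathbb{C}^2:|z_1|<1,|z_2|<1\}$, $\mathbb{Z}_+=\{0,1,2,\dots\}$, $\mathbb{R}_+=[0,\infty)$. A constant $\beta>1$ is fixed. $\mathbf{L}(z)=(l_1(z),l_2(z))$, where each $l_j\colon\mathbb{D}^2\to\mathbb{R}_+$ is continuous and satisfies $l_j(z_1,z_2)>\beta/(1-|z_j|)$ for all $(z_1,z_2)\in\mathbb{D}^2$, $j=1,2$. For $z^0\in\mathbb{C}^2$ and $R=(r_1,r_2)\in\mathbb{R}_+^2$: $\mathbb{D}^2[z^0,R]=\{z:|z_j-z_j^0|\le r_j,\ j=1,2\}$ and $\frac{R}{\mathbf{L}(z^0)}=\big(\frac{r_1}{l_1(z^0)},\frac{r_2}{l_2(z^0)}\big)$. $F^{(p,q)}=\frac{\partial^{p+q}F}{\partial z_1^p\partial z_2^q}$. An analytic $F\colon\mathbb{D}^2\to\mathbb{C}$ has bounded $\mathbf{L}$-index in joint variables if there is $n_0\in\mathbb{Z}_+$ such that for all $z\in\mathbb{D}^2$ and all $(p_1,p_2)\in\mathbb{Z}_+^2$: $\frac{|F^{(p_1,p_2)}(z)|}{p_1!p_2!\,l_1^{p_1}(z)l_2^{p_2}(z)}\le\max\{\frac{|F^{(k_1,k_2)}(z)|}{k_1!k_2!\,l_1^{k_1}(z)l_2^{k_2}(z)}:0\le k_1+k_2\le n_0\}$. $Q^2(\mathbb{D}^2)$ is the class of such $\mathbf{L}$ for which, for all $R=(r_1,r_2)\in[0,\beta]^2$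 and $j=1,2$, $0<\lambda_{1,j}(R)\le\lambda_{2,j}(R)<\infty$, where $\lambda_{1,j}(R)=\inf_{z^0\in\mathbb{D}^2}\inf\{l_j(z)/l_j(z^0): z\in\mathbb{D}^2[z^0,R/\mathbf{L}(z^0)]\}$ and $\lambda_{2,j}(R)=\sup_{z^0\in\mathbb{D}^2}\sup\{l_j(z)/l_j(z^0): z\in\mathbb{D}^2[z^0,R/\mathbf{L}(z^0)]\}$. *)

(* Defs.v *)
(* Complex numbers are R[i] (mathcomp-real-closed)
   over an arbitrary R : realType, viewed as a numFieldType (hence a normed
   module over itself, with its topology). *)
From HB Require Import structures.
From mathcomp Require Import all_boot all_order all_algebra.
From mathcomp Require Import all_classical all_reals all_analysis.
From mathcomp Require Import complex.
Set Implicit Arguments. Unset Strict Implicit. Unset Printing Implicit Defensive.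
Import Order.TTheory GRing.Theory Num.Theory numFieldNormedType.Exports.
Local Open Scope ring_scope.
Local Open Scope classical_set_scope.

Definition CC (R : realType) : numFieldType := R[i].

Definition cabs (R : realType) (z : CC R) : R := ComplexField.Normc.normc z.

Definition D2 (R : realType) : set (CC R * CC R) :=
  [set z | cabs z.1 < 1 /\ cabs z.2 < 1].

Definition polydisc (R : realType) (z0 : CC R * CC R) (r1 r2 : R)
  : set (CC R * CC R) :=
  [set z | cabs (z.1 - z0.1) <= r1 /\ cabs (z.2 - z0.2) <= r2].

Definition analytic_D2 (R : realType) (F : CC R * CC R -> CC R) : Prop :=
  forall z0, D2 z0 ->
  exists (r : R) (a : nat -> nat -> CC R), 0 < r /\
    forall z, cabs (z.1 - z0.1) < r -> cabs (z.2 - z0.2) < r ->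
      (exists M : R, forall N : nat,
         \sum_(m < N) \sum_(n < N)
            cabs (a m n * (z.1 - z0.1) ^+ m * (z.2 - z0.2) ^+ n) <= M) /\
      ((fun N : nat => \sum_(m < N) \sum_(n < N)
            (a m n * (z.1 - z0.1) ^+ m * (z.2 - z0.2) ^+ n)) @ \oo --> F z).

Definition dz1 (R : realType) (F : CC R * CC R -> CC R) : CC R * CC R -> CC R :=
  fun z => derive1 (fun w : CC R => F (w, z.2)) z.1.
Definition dz2 (R : realType) (F : CC R * CC R -> CC R) : CC R * CC R -> CC R :=
  fun z => derive1 (fun w : CC R => F (z.1, w)) z.2.

Definition Fder (R : realType) (F : CC R * CC R -> CC R) (p q : nat)
  : CC R * CC R -> CC R :=
  iter p (@dz1 R) (iter q (@dz2 R) F).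

Definition Lterm (R : realType) (l1 l2 : CC R * CC R -> R)
  (F : CC R * CC R -> CC R) (k1 k2 : nat) (z : CC R * CC R) : R :=
  cabs (Fder F k1 k2 z) / ((k1`!)%:R * (k2`!)%:R * l1 z ^+ k1 * l2 z ^+ k2).

Definition bounded_L_index (R : realType) (l1 l2 : CC R * CC R -> R)
  (F : CC R * CC R -> CC R) : Prop :=
  exists n0 : nat, forall z, D2 z -> forall p1 p2 : nat,
    Lterm l1 l2 F p1 p2 z <=
    \big[Num.max/0]_(k1 < n0.+1)
      \big[Num.max/0]_(k2 < n0.+1 | (k1 + k2 <= n0)%N) Lterm l1 l2 F k1 k2 z.

Definition ratio_set (R : realType) (l1 l2 l : CC R * CC R -> R) (r1 r2 : R)
  : set (\bar R) :=
  [set x | exists z0, D2 z0 /\ exists z,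
      polydisc z0 (r1 / l1 z0) (r2 / l2 z0) z /\ x = (l z / l z0)%:E].

Definition lambda1 (R : realType) (l1 l2 l : CC R * CC R -> R) (r1 r2 : R)
  : \bar R := ereal_inf (ratio_set l1 l2 l r1 r2).
Definition lambda2 (R : realType) (l1 l2 l : CC R * CC R -> R) (r1 r2 : R)
  : \bar R := ereal_sup (ratio_set l1 l2 l r1 r2).

Definition Q2 (R : realType) (beta : R) (l1 l2 : CC R * CC R -> R) : Prop :=
  forall r1 r2 : R, 0 <= r1 <= beta -> 0 <= r2 <= beta ->
  forall l, (l = l1 \/ l = l2) ->
    (0 < lambda1 l1 l2 l r1 r2)%E /\
    (lambda1 l1 l2 l r1 r2 <= lambda2 l1 l2 l r1 r2)%E /\
    (lambda2 l1 l2 l r1 r2 < +oo)%E.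

(* Main.v *)
(* Necessity. If F has bounded L-index with bound N, freeze the weights l_j at z0
   and let S(w) be the resulting sum of the terms of order at most N. Since l_j(w)
   and l_j(z0) are comparable near z0 and the terms of order N + 1 are controlled
   by those of order at most N, both partial derivatives of the terms of S are
   O(l_j(z0) S(w)); hence on a polydisc of radii r / l_j(z0) with r small, S at most
   doubles along each of the two coordinate segments from z0 to w.

   Sufficiency. The hypothesis says that the maximum of the terms of order at most
   n0 grows at most by the factor p0 over a polydisc of radii r_j / l_j(z0).
   Chaining boundedly many such polydiscs reaches radii beta / l_j(z0), and
   Cauchy's inequality on that larger polydisc bounds the term of order (p,q) by
   P beta^-(p+q) times the maximum at z0. As beta > 1, this is at most the maximum
   once p + q is large.

   Cauchy's inequality is obtained without integration, from the maximum principle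
   applied to averages of F over roots of unity. *)
Require Import Defs.
From HB Require Import structures.
From mathcomp Require Import all_boot all_order all_algebra.
From mathcomp Require Import all_classical all_reals all_analysis.
From mathcomp Require Import complex.
From mathcomp Require Import cyclic separable cyclotomic ring lra zify.
Import Order.TTheory GRing.Theory Num.Theory numFieldNormedType.Exports.
Local Open Scope ring_scope.
Local Open Scope classical_set_scope.

Set Implicit Arguments. Unset Strict Implicit. Unset Printing Implicit Defensive.

(** * The modulus and complex derivatives *)

Section Cabs.
Variable R : realType.
Local Notation C := (CC R).
Implicit Types (x y z w : C) (f g : C -> C).

(** The weights are merely continuous, so the terms of the index cannot be differentiated in z; this
    is why the weights are frozen at z0. Moving between l_j(w) and l_j(z0) rests on [Q2] at R =
    (beta, beta). A modulus is not differentiable at zeros either, so no differential inequality for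
    S is written: the mean value inequality is applied to each derivative of F separately, and the
    resulting bounds are summed at a point where S is maximal.

    The bound l_j > beta / (1 - |z_j|) says exactly that the closed polydisc of radii beta / l_j(z0)
    lies inside the bidisc with room to spare, which is what Cauchy's inequality asks for.

    Analyticity is given by local double power series, whereas [Fder] iterates [derive1], a limit
    that has a value even where no derivative exists. Termwise differentiation bridges the two. It
    is proved on a polydisc of a quarter of the radius; the loss is harmless, since every point of
    the bidisc is the centre of its own expansion. The same expansions make mixed derivatives
    commute, as required by the fixed order of differentiation in [Fder]. *)

Definition rC (a : R) : C := a%:C%C.

Lemma rCD (a b : R) : rC (a + b) = rC a + rC b. Proof. exact: rmorphD. Qed.
Lemma rCM (a b : R) : rC (a * b) = rC a * rC b. Proof. exact: rmorphM. Qed.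
Lemma rCN (a : R) : rC (- a) = - rC a. Proof. exact: rmorphN. Qed.
Lemma rC0 : rC 0 = 0. Proof. by []. Qed.
Lemma rC1 : rC 1 = 1. Proof. by []. Qed.
Lemma rCV (a : R) : rC a^-1 = (rC a)^-1. Proof. exact: fmorphV. Qed.
Lemma rC_nat n : rC n%:R = n%:R. Proof. exact: rmorph_nat. Qed.

Lemma norm_cabs z : `|z| = rC (cabs z).
Proof. by case: z. Qed.

Lemma rC_lt (a b : R) : (rC a < rC b) = (a < b). Proof. exact: ltcR. Qed.
Lemma rC_le (a b : R) : (rC a <= rC b) = (a <= b). Proof. exact: lecR. Qed.
Lemma rC_inj (a b : R) : rC a = rC b -> a = b. Proof. by move=> []. Qed.

Lemma cabs_ge0 z : 0 <= cabs z.
Proof. by rewrite -rC_le -norm_cabs normr_ge0. Qed.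
Lemma cabsM x y : cabs (x * y) = cabs x * cabs y.
Proof. by apply: rC_inj; rewrite rCM -!norm_cabs normrM. Qed.
Lemma cabsX x n : cabs (x ^+ n) = cabs x ^+ n.
Proof.
elim: n => [|n IH]; first by apply: rC_inj; rewrite -norm_cabs normr1.
by rewrite !exprS cabsM IH.
Qed.
Lemma cabsD x y : cabs (x + y) <= cabs x + cabs y.
Proof. by rewrite -rC_le rCD -!norm_cabs ler_normD. Qed.
Lemma cabsN x : cabs (- x) = cabs x.
Proof. by apply: rC_inj; rewrite -!norm_cabs normrN. Qed.
Lemma cabs_distC x y : cabs (x - y) = cabs (y - x).
Proof. by rewrite -cabsN opprB. Qed.
Lemma cabs_tri z x y : cabs (x - y) <= cabs (x - z) + cabs (z - y).
Proof. by rewrite (le_trans _ (cabsD _ _)) // addrA subrK. Qed.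
Lemma cabs0 : cabs (0 : C) = 0.
Proof. by apply: rC_inj; rewrite -norm_cabs normr0. Qed.
Lemma cabs1 : cabs (1 : C) = 1.
Proof. by apply: rC_inj; rewrite -norm_cabs normr1. Qed.
Lemma cabs_eq0 z : (cabs z == 0) = (z == 0).
Proof.
apply/eqP/eqP => [h|->]; last exact: cabs0.
by apply/eqP; rewrite -normr_eq0 norm_cabs h.
Qed.
Lemma cabs_gt0 z : (0 < cabs z) = (z != 0).
Proof. by rewrite lt_def cabs_eq0 cabs_ge0 andbT. Qed.
Lemma cabsV x : cabs x^-1 = (cabs x)^-1.
Proof. by apply: rC_inj; rewrite rCV -!norm_cabs normfV. Qed.
Lemma cabs_rC (a : R) : cabs (rC a) = `|a|.
Proof. by rewrite /cabs /= expr0n /= addr0 sqrtr_sqr. Qed.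
Lemma cabs_nat n : cabs (n%:R : C) = n%:R.
Proof. by rewrite -rC_nat cabs_rC normr_nat. Qed.
Lemma cabs_sum I (s : seq I) (P : pred I) (G : I -> C) :
  cabs (\sum_(i <- s | P i) G i) <= \sum_(i <- s | P i) cabs (G i).
Proof.
elim/big_ind2 : _ => [|x1 x2 y1 y2 h1 h2|//]; first by rewrite cabs0.
by rewrite (le_trans (cabsD _ _)) // lerD.
Qed.
Lemma cabs_lerB x y : cabs x - cabs y <= cabs (x - y).
Proof. by rewrite lerBlDr (le_trans _ (cabsD _ _)) // subrK. Qed.

(** The real inner product of the plane. Pairing with a fixed vector turns complex values into real
    ones, to which real mean value and maximum arguments apply. *)
Definition cdot z w : R := complex.Re z * complex.Re w + complex.Im z * complex.Im w.

Lemma cabs_sqr z : cabs z ^+ 2 = cdot z z.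
Proof.
by case: z => a b; rewrite /cabs /cdot /= sqr_sqrtr ?expr2 // addr_ge0 // sqr_ge0.
Qed.
Lemma cdotDr z x y : cdot z (x + y) = cdot z x + cdot z y.
Proof. by case: z x y => [a b] [c d] [e g]; rewrite /cdot /=; ring. Qed.
Lemma cdotNr z x : cdot z (- x) = - cdot z x.
Proof. by case: z x => [a b] [c d]; rewrite /cdot /=; ring. Qed.
Lemma cdotZr z x (a : R) : cdot z (rC a * x) = a * cdot z x.
Proof. by case: z x => [e b] [c d]; rewrite /cdot /=; ring. Qed.
Lemma cdot_le z w : `|cdot z w| <= cabs z * cabs w.
Proof.
rewrite -(@ler_pXn2r _ 2) ?nnegrE ?mulr_ge0 ?cabs_ge0 //.
rewrite exprMn real_normK ?num_real // !cabs_sqr.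
case: z w => [a b] [c d]; rewrite /cdot /= -subr_ge0.
rewrite [leRHS](_ : _ = (a * d - b * c) ^+ 2); last by ring.
exact: sqr_ge0.
Qed.

Lemma cabs_Re z : `|complex.Re z| <= cabs z.
Proof.
case: z => a b; rewrite /cabs /= -sqrtr_sqr ler_wsqrtr // lerDl; exact: sqr_ge0.
Qed.
Lemma cabs_Im z : `|complex.Im z| <= cabs z.
Proof.
case: z => a b; rewrite /cabs /= -sqrtr_sqr ler_wsqrtr // lerDr; exact: sqr_ge0.
Qed.
Lemma cabs_ReIm z : cabs z <= `|complex.Re z| + `|complex.Im z|.
Proof.
rewrite -(@ler_pXn2r _ 2) ?nnegrE ?addr_ge0 ?cabs_ge0 // cabs_sqr.
rewrite /cdot -!expr2 -[X in X + _ <= _]real_normK ?num_real // -[X in _ + X <= _]real_normK ?num_real //.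
rewrite sqrrD -addrA lerD2l lerDr mulrn_wge0 // mulr_ge0 //.
Qed.

(** The topology of [C] quantifies over positive elements of [C] itself. Such elements are real, so
    real tolerances suffice. *)
Lemma ccvgP {T : Type} {Fi : set_system T} {FF : Filter Fi} (f : T -> C) (l : C) :
  f @ Fi --> l <-> forall e : R, 0 < e -> \forall t \near Fi, cabs (l - f t) < e.
Proof.
split => [/cvgrPdist_lt h e e0|h].
  have := h (rC e); rewrite -[X in X < _]rC0 rC_lt => /(_ e0).
  by apply: filterS => t; rewrite norm_cabs rC_lt.
apply/cvgrPdist_lt => e e0.
have er : e = rC (complex.Re e) by rewrite -[e in LHS]RRe_real // gtr0_real.
rewrite er in e0 *.
have := h (complex.Re e); rewrite -rC_lt => /(_ e0).
by apply: filterS => t; rewrite norm_cabs rC_lt.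
Qed.

(** A relation that asserts differentiability, which an equation on the total [derive1] would not.
    Written without division, it allows h = 0 and adds up easily. *)
Definition cderiv f z (d : C) := forall e : R, 0 < e ->
  exists2 del : R, 0 < del & forall h, cabs h < del ->
    cabs (f (z + h) - f z - d * h) <= e * cabs h.

Lemma nbhs_cabs z (e : R) : 0 < e -> \forall w \near z, cabs (w - z) < e.
Proof.
move=> e0; have := @cvg_id C (nbhs z); move/(ccvgP _ _)=> /(_ _ e0).
by apply: filterS => w; rewrite cabs_distC.
Qed.

Lemma cderiv_derive1 f z d : cderiv f z d -> derive1 f z = d.
Proof.
move=> h; rewrite /derive1; apply: cvg_lim; first exact: norm_hausdorff.
apply/ccvgP => e e0.
have [del del0 hd] := h _ (divr_gt0 e0 (ltr0n _ 2)).
have := nbhs_cabs 0 del0.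
apply: filterS => w; rewrite subr0 => wd w0.
have := hd _ wd.
rewrite -[X in cabs (d - X)]/(w^-1 * (f (w + z) - f z)).
have cw : 0 < cabs w by rewrite cabs_gt0.
have -> : d - w^-1 * (f (w + z) - f z) = - (w^-1 * (f (z + w) - f z - d * w)).
  by rewrite (addrC w z); field.
rewrite cabsN cabsM cabsV => le1.
apply: (@le_lt_trans _ _ (e / 2)).
  rewrite mulrC ler_pdivrMr //.
lra.
Qed.

Lemma cderiv_ext f g z d (r : R) : 0 < r -> 
  (forall w, cabs (w - z) < r -> f w = g w) -> cderiv f z d -> cderiv g z d.
Proof.
move=> r0 h hf e e0; have [del del0 H] := hf e e0.
exists (Num.min del r); first by rewrite lt_min del0.
move=> w; rewrite lt_min => /andP[w1 w2].
by rewrite -!h ?subrr ?cabs0 // ?[z + w]addrC ?addrK //; rewrite addrC; exact: H.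
Qed.

Lemma cderivD f g z d d' : cderiv f z d -> cderiv g z d' ->
  cderiv (fun w => f w + g w) z (d + d').
Proof.
move=> hf hg e e0; have e2 := divr_gt0 e0 (ltr0n _ 2).
have [d1 d10 h1] := hf _ e2; have [d2 d20 h2] := hg _ e2.
exists (Num.min d1 d2); first by rewrite lt_min d10.
move=> w; rewrite lt_min => /andP[/h1 w1 /h2 w2].
have -> : f (z + w) + g (z + w) - (f z + g z) - (d + d') * w =
  (f (z + w) - f z - d * w) + (g (z + w) - g z - d' * w) by ring.
apply: (le_trans (cabsD _ _)); lra.
Qed.

Lemma cderivZ f z d c : cderiv f z d -> cderiv (fun w => c * f w) z (c * d).
Proof.
move=> hf e e0; have c1 : 0 < cabs c + 1 by rewrite ltr_wpDl ?cabs_ge0.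
have [d1 d10 h1] := hf _ (divr_gt0 e0 c1).
exists d1 => // w /h1 w1.
have -> : c * f (z + w) - c * f z - c * d * w = c * (f (z + w) - f z - d * w) by ring.
rewrite cabsM; apply: (le_trans (ler_wpM2l (cabs_ge0 _) w1)).
rewrite mulrA ler_wpM2r ?cabs_ge0 // mulrCA ler_piMr ?(ltW e0) //.
rewrite ler_pdivrMr // mul1r lerDl //.
Qed.

Lemma cderiv_cts f z d : cderiv f z d -> forall e : R, 0 < e ->
  exists2 del : R, 0 < del & forall w, cabs (w - z) < del -> cabs (f w - f z) <= e.
Proof.
move=> hf e e0; have [d1 d10 h1] := hf _ ltr01.
have c1 : 0 < cabs d + 1 by rewrite ltr_wpDl ?cabs_ge0.
exists (Num.min d1 (e / (cabs d + 1))); first by rewrite lt_min d10 divr_gt0.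
move=> w; rewrite lt_min => /andP[/h1]; rewrite (addrC z) subrK => h2.
rewrite ltr_pdivlMr // => h3.
have -> : f w - f z = (f w - f z - d * (w - z)) + d * (w - z) by ring.
apply: (le_trans (cabsD _ _)); rewrite cabsM; lra.
Qed.

Lemma cderiv_cst c z : cderiv (fun=> c) z 0.
Proof. by move=> e e0; exists 1 => // h _; rewrite subrr mul0r subr0 cabs0 mulr_ge0 ?(ltW e0) ?cabs_ge0. Qed.

Lemma cderiv_shiftX n v z : cderiv (fun w => (w - v) ^+ n) z (n%:R * (z - v) ^+ n.-1).
Proof.
elim: n => [|n IH]; first by rewrite mul0r; exact: cderiv_cst.
move=> e e0; have c1 : 0 < cabs (z - v) + 1 by rewrite ltr_wpDl ?cabs_ge0.
have [d1 d10 h1] := IH _ (divr_gt0 (divr_gt0 e0 (ltr0n _ 2)) c1).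
have [d2 d20 h2] := cderiv_cts IH (divr_gt0 e0 (ltr0n _ 2)).
exists (Num.min d1 d2); first by rewrite lt_min d10.
move=> h; rewrite lt_min => /andP[/h1 g1 g2].
have := h2 (z + h); rewrite (addrC z) addrK => /(_ g2) g3.
(* Product rule by hand: (z - v) times the remainder of the n-th power, plus h times its increment.
   The second part is o(h) by continuity. The truncated exponent at n = 0 is multiplied by n = 0. *)
rewrite -[X in cabs X](_ : (z - v) * ((z + h - v) ^+ n - (z - v) ^+ n - n%:R * (z - v) ^+ n.-1 * h) + h * ((h + z - v) ^+ n - (z - v) ^+ n) = _); last first.
  rewrite !exprS (addrC h z).
  case: n {IH h1 h2 g1 g3} => [|n]; first by rewrite !expr0; ring.
  rewrite /= -(natr1 n.+1) !exprS; ring.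
apply: (le_trans (cabsD _ _)); rewrite !cabsM.
have : cabs (z - v) * cabs ((z + h - v) ^+ n - (z - v) ^+ n - n%:R * (z - v) ^+ n.-1 * h) <= e / 2 * cabs h.
  apply: (le_trans (ler_wpM2l (cabs_ge0 _) g1)).
  rewrite mulrA ler_wpM2r ?cabs_ge0 // mulrCA ler_piMr ?divr_ge0 ?(ltW e0) //.
  by rewrite ler_pdivrMr // mul1r lerDl.
have := ler_wpM2l (cabs_ge0 h) g3.
lra.
Qed.

End Cabs.

(** * Mean value inequality and Taylor expansions *)

Section MVI.
Variable R : realType.
Local Notation C := (CC R).
Implicit Types (x y z w : C) (f g : C -> C).

Lemma is_derive_epsdelta (phi : R -> R) (x d : R) :
  (forall e : R, 0 < e -> exists2 del : R, 0 < del & forall h, `|h| < del ->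
    `|phi (x + h) - phi x - d * h| <= e * `|h|) -> is_derive x 1 phi d.
Proof.
move=> H.
suff cv : (fun h : R => h^-1 *: (phi (h *: 1 + x) - phi x)) @ 0^' --> d.
  by split; [apply/cvg_ex; exists d | exact: cvg_lim].
apply/cvgrPdist_lt => e e0.
have [del del0 hd] := H _ (divr_gt0 e0 (ltr0n _ 2)).
have : \forall w \near (0 : R), `|w| < del.
  by have := nbhsx_ballx (0 : R) _ del0; apply: filterS => w; rewrite /ball /= sub0r normrN.
apply: filterS => w wd w0.
have := hd _ wd.
have cw : 0 < `|w| by rewrite normr_gt0.
have -> : d - w^-1 *: (phi (w *: 1 + x) - phi x) = - (w^-1 * (phi (x + w) - phi x - d * w)).
  by rewrite /GRing.scale /= mulr1 (addrC w x); field.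
rewrite normrN normrM normfV => le1.
apply: (@le_lt_trans _ _ (e / 2)).
  rewrite mulrC ler_pdivrMr //.
lra.
Qed.

(* The real mean value theorem applied to t |-> <f b - f a, f (a + t (b - a))>. *)
Lemma mean_value_ineq f (df : C -> C) a b (K : R) :
  (forall t : R, 0 <= t <= 1 -> cderiv f (a + rC t * (b - a)) (df (a + rC t * (b - a)))) ->
  (forall t : R, 0 <= t <= 1 -> cabs (df (a + rC t * (b - a))) <= K) ->
  cabs (f b - f a) <= K * cabs (b - a).
Proof.
move=> hf hK; set c := f b - f a.
pose phi t := cdot c (f (a + rC t * (b - a))).
pose dphi t := cdot c (df (a + rC t * (b - a)) * (b - a)).
have K0 : 0 <= K by apply: le_trans (hK 0 _); rewrite ?cabs_ge0 ?lexx ?ler01.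
have hd (t : R) : 0 <= t <= 1 -> is_derive t 1 phi (dphi t).
  move=> t01; apply: is_derive_epsdelta => e e0.
  have c1 : 0 < cabs c * cabs (b - a) + 1 by rewrite ltr_wpDl ?mulr_ge0 ?cabs_ge0.
  have b1 : 0 < cabs (b - a) + 1 by rewrite ltr_wpDl ?cabs_ge0.
  have [del del0 H] := hf _ t01 _ (divr_gt0 e0 c1).
  exists (del / (cabs (b - a) + 1)); first exact: divr_gt0.
  move=> h; rewrite ltr_pdivlMr // => hh.
  have := H (rC h * (b - a)); rewrite cabsM cabs_rC.
  have -> : `|h| * cabs (b - a) < del.
    by apply: le_lt_trans hh; rewrite ler_wpM2l // lerDl.
  move=> /(_ isT) H1; rewrite /phi /dphi rCD mulrDl.
  rewrite addrA; set u := a + rC t * (b - a) in H1 *.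
  rewrite [X in `|X|](_ : _ = cdot c (f (u + rC h * (b - a)) - f u - df u * (rC h * (b - a)))); last first.
    by rewrite !cdotDr !cdotNr mulrCA cdotZr; ring.
  apply: (le_trans (cdot_le _ _)).
  apply: (le_trans (ler_wpM2l (cabs_ge0 _) H1)).
  rewrite [leLHS](_ : _ = e * `|h| * (cabs c * cabs (b - a) / (cabs c * cabs (b - a) + 1))); last by ring.
  rewrite ler_piMr ?mulr_ge0 ?(ltW e0) //.
  by rewrite ler_pdivrMr // mul1r lerDl.
have hd1 (t : R) : t \in `]0, 1[%R -> is_derive t 1 phi (dphi t).
  move=> t01; apply: hd; move: t01; rewrite in_itv /= => /andP[t0 t1]; rewrite !ltW //.
have [|t t01 eqn] := MVT_segment ler01 hd1.
  apply: derivable_within_continuous => t; rewrite in_itv /= => t01.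
    by have [] := hd _ t01.
move: eqn; rewrite /phi /dphi -cdotNr -cdotDr rC1 rC0 mul1r mul0r addr0 subr0 mulr1 (addrC a) subrK -/c -cabs_sqr => eqn.
have [c0|c0] := eqVneq (cabs c) 0; first by rewrite c0 mulr_ge0 ?cabs_ge0.
have cp : 0 < cabs c by rewrite lt_def c0 cabs_ge0.
rewrite -(ler_pM2l cp) -expr2 eqn (le_trans (ler_norm _)) // (le_trans (cdot_le _ _)) //.
rewrite ler_wpM2l ?cabs_ge0 // cabsM ler_wpM2r ?cabs_ge0 //.
apply: hK; move: t01; by rewrite in_itv.
Qed.

Lemma cderivB f g z d d' : cderiv f z d -> cderiv g z d' ->
  cderiv (fun w => f w - g w) z (d - d').
Proof.
move=> hf hg; have := cderivD hf (cderivZ (-1) hg); rewrite mulN1r.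
by apply: (cderiv_ext ltr01) => w _; rewrite mulN1r.
Qed.

Lemma cderiv_sum n (F : 'I_n -> C -> C) (D : 'I_n -> C) z :
  (forall i, cderiv (F i) z (D i)) -> cderiv (fun w => \sum_(i < n) F i w) z (\sum_(i < n) D i).
Proof.
elim: n F D => [|n IH] F D h.
  rewrite big_ord0 [X in cderiv X](_ : _ = fun=> 0); first exact: cderiv_cst.
  by apply/funext => w; rewrite big_ord0.
rewrite big_ord_recl [X in cderiv X](_ : _ = fun w => F ord0 w + \sum_(i < n) F (lift ord0 i) w).
  by apply: cderivD => //; apply: IH.
by apply/funext => w; rewrite big_ord_recl.
Qed.

(** The successive derivatives are carried as data, so that dropping the first function leaves a
    tower again and inductions on the order go through. The towers of interest are the [Fder] along
    one variable. *)
Definition tower (c : C) (r : R) (fs : nat -> C -> C) :=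
  forall k w, cabs (w - c) < r -> cderiv (fs k) w (fs k.+1 w).

Lemma tower_shift c r fs : tower c r fs -> tower c r (fun k => fs k.+1).
Proof. by move=> h k; exact: h. Qed.

Lemma tower_sub c c' (r r' : R) fs : cabs (c' - c) + r' <= r -> tower c r fs -> tower c' r' fs.
Proof.
move=> h tw k w wc; apply: tw.
by apply: (le_lt_trans (cabs_tri c' _ _)); lra.
Qed.

(** The order n + 1 remainder vanishes at c, and its derivative is the order n remainder of the
    shifted tower. The mean value inequality on the segment from c therefore gains one power of |w -
    c| with the same K. *)
Lemma tower_taylor n c r fs : 0 < r -> tower c r fs ->
  exists K del : R, [/\ 0 < del, 0 <= K & forall w, cabs (w - c) < del ->
    cabs (fs 0%N w - \sum_(k < n) (fs k c / (k`!)%:R) * (w - c) ^+ k) <= K * cabs (w - c) ^+ n].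
Proof.
move=> r0; elim: n fs => [|n IH] fs tw.
  have := tw 0%N c; rewrite subrr cabs0 => /(_ r0) /cderiv_cts /(_ _ ltr01)[del del0 H].
  exists (cabs (fs 0%N c) + 1), del; split => [//||w /H wd].
    by rewrite addr_ge0 ?cabs_ge0.
  rewrite big_ord0 subr0 expr0 mulr1.
  by have := cabsD (fs 0%N w - fs 0%N c) (fs 0%N c); rewrite subrK; lra.
have [K [del [del0 K0 H]]] := IH _ (tower_shift tw).
exists K, (Num.min del r); split => [|//|w]; first by rewrite lt_min del0.
rewrite lt_min => /andP[wd wr].
pose E v := fs 0%N v - \sum_(k < n.+1) (fs k c / (k`!)%:R) * (v - c) ^+ k.
pose dE v := fs 1%N v - \sum_(k < n) (fs k.+1 c / (k`!)%:R) * (v - c) ^+ k.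
have hE v : cabs (v - c) < r -> cderiv E v (dE v).
  move=> vr; apply: cderivB; first exact: tw.
  rewrite -[X in cderiv _ _ X](_ : \sum_(k < n.+1) fs k c / k`!%:R * (k%:R * (v - c) ^+ k.-1) = _).
    by apply: cderiv_sum => i; apply: cderivZ; exact: cderiv_shiftX.
  rewrite big_ord_recl /= mul0r mulr0 add0r; apply: eq_bigr => i _.
  rewrite /bump /= add1n factS natrM mulrA; congr (_ * _).
  by rewrite invfM mulrA mulrAC divfK // pnatr_eq0.
have E0 : E c = 0.
  rewrite /E big_ord_recl /= subrr expr0 fact0 divr1 mulr1 big1 ?addr0 ?subrr //.
  by move=> i _; rewrite expr0n /= mulr0.
rewrite -/(E w) -[E w]subr0 -[X in _ - X]E0 exprSr mulrA.
have key (t : R) : 0 <= t <= 1 -> cabs (c + rC t * (w - c) - c) <= cabs (w - c).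
  move=> /andP[t0 t1].
  by rewrite addrAC subrr add0r cabsM cabs_rC ger0_norm // ler_piMl ?cabs_ge0.
apply: (mean_value_ineq (df := dE)) => t /key ht.
  by apply: hE; apply: le_lt_trans wr.
apply: (le_trans (H _ _)); first by apply: le_lt_trans wd.
by rewrite ler_wpM2l // lerXn2r ?nnegrE ?cabs_ge0.
Qed.

(* Unlike towers, functions with such an expansion at every point are visibly
   closed under products and inverses; the expansion is all that the maximum
   principle needs. *)
Definition T3 f w := exists (a b : C) (K del : R), [/\ 0 < del, 0 <= K &
  forall h, cabs h < del -> cabs (f (w + h) - (f w + a * h + b * h ^+ 2)) <= K * cabs h ^+ 3].

Lemma tower_T3 c r fs w : tower c r fs -> cabs (w - c) < r -> T3 (fs 0%N) w.
Proof.
move=> tw wc; have r0 : 0 < r - cabs (w - c) by rewrite subr_gt0.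
have [|K [del [d0 K0 H]]] := @tower_taylor 3 w _ fs r0.
  by apply: tower_sub tw; rewrite addrC subrK.
exists (fs 1%N w), (fs 2%N w / 2), K, del; split => // h hd.
have := H (w + h); rewrite addrAC subrr add0r => /(_ hd).
by rewrite !big_ord_recl big_ord0 /= /bump /= !addn0 !expr0 !expr1 !addrA addr0 !divr1 mulr1.
Qed.

Lemma T3D f g w : T3 f w -> T3 g w -> T3 (fun v => f v + g v) w.
Proof.
move=> [a [b [K [d [d0 K0 H]]]]] [a' [b' [K' [d' [d'0 K'0 H']]]]].
exists (a + a'), (b + b'), (K + K'), (Num.min d d'); split; rewrite ?lt_min ?d0 ?addr_ge0 //.
move=> h; rewrite lt_min => /andP[/H h1 /H' h2].
rewrite -[X in cabs X](_ : (f (w + h) - (f w + a * h + b * h ^+ 2)) + (g (w + h) - (g w + a' * h + b' * h ^+ 2)) = _); last by ring.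
by rewrite (le_trans (cabsD _ _)) // mulrDl lerD.
Qed.

Lemma T3_cst c w : T3 (fun=> c) w.
Proof.
exists 0, 0, 0, 1; split => // h _.
by rewrite !mul0r !addr0 subrr cabs0.
Qed.

Lemma T3M f g w : T3 f w -> T3 g w -> T3 (fun v => f v * g v) w.
Proof.
move=> [a [b [K [d [d0 K0 H]]]]] [a' [b' [K' [d' [d'0 K'0 H']]]]].
set A := cabs (f w) + cabs a + cabs b; set B := cabs (g w) + cabs a' + cabs b' + K'.
have A0 : 0 <= A by rewrite !addr_ge0 ?cabs_ge0.
have B0 : 0 <= B by rewrite !addr_ge0 ?cabs_ge0.
exists (f w * a' + a * g w), (f w * b' + a * a' + b * g w),
  (A * K' + K * B + cabs (a * b' + b * a') + cabs (b * b')), (Num.min 1 (Num.min d d')).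
split; rewrite ?lt_min ?d0 ?ltr01 //; first by rewrite !addr_ge0 ?mulr_ge0 ?cabs_ge0.
move=> h; rewrite !lt_min => /and3P[h1 /H hf /H' hg].
set x := cabs h in h1 hf hg *; have x0 : 0 <= x by exact: cabs_ge0.
have x2 : x ^+ 2 <= 1 by rewrite exprn_ile1 // ltW.
have x3 : x ^+ 3 <= 1 by rewrite exprn_ile1 // ltW.
have x30 : 0 <= x ^+ 3 by rewrite exprn_ge0.
set P := f w + a * h + b * h ^+ 2; set Q := g w + a' * h + b' * h ^+ 2.
rewrite -/P in hf; rewrite -/Q in hg.
have hP : cabs P <= A.
  rewrite /P (le_trans (cabsD _ _)) // lerD ?(le_trans (cabsD _ _)) // ?lerD //.
    by rewrite cabsM ler_piMr ?cabs_ge0 // ltW.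
  by rewrite cabsM cabsX ler_piMr ?cabs_ge0.
have hQ : cabs (g (w + h)) <= B.
  rewrite -[g _](subrK Q) (le_trans (cabsD _ _)) // addrC lerD //.
    rewrite /Q (le_trans (cabsD _ _)) // lerD ?(le_trans (cabsD _ _)) // ?lerD //.
      by rewrite cabsM ler_piMr ?cabs_ge0 // ltW.
    by rewrite cabsM cabsX ler_piMr ?cabs_ge0.
  by rewrite (le_trans hg) // ler_piMr.
(* With P and Q the quadratic parts, the error is P (g - Q) + (f - P) g plus the monomials of degree
   3 and 4 of P Q. The radius is at most 1, so |h|^4 is bounded by |h|^3. *)
rewrite -[X in cabs X](_ : P * (g (w + h) - Q) + (f (w + h) - P) * g (w + h) + (a * b' + b * a') * h ^+ 3 + (b * b') * h ^+ 3 * h = _); last by rewrite /P /Q; ring.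
set e1 := a * b' + b * a'.
rewrite [leRHS](_ : _ = A * K' * x ^+ 3 + K * B * x ^+ 3 + cabs e1 * x ^+ 3 + cabs (b * b') * x ^+ 3); last by ring.
rewrite (le_trans (cabsD _ _)) // lerD //; last first.
  by rewrite (cabsM _ h) (cabsM _ (h ^+ 3)) cabsX ler_piMr ?mulr_ge0 ?cabs_ge0 // ltW.
rewrite (le_trans (cabsD _ _)) // lerD //; last first.
  by rewrite (cabsM _ (h ^+ 3)) cabsX.
rewrite (le_trans (cabsD _ _)) // lerD //.
  by rewrite cabsM -mulrA ler_pM ?cabs_ge0.
by rewrite cabsM mulrAC ler_pM ?cabs_ge0.
Qed.

(** The remainder is exactly - h^3 / (w^3 (w + h)), and |w + h| >= |w| / 2 for small h, whence the
    constant 2 / |w|^4. *)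
Lemma T3_inv w : w != 0 -> T3 (fun v => v^-1) w.
Proof.
move=> w0; have cw : 0 < cabs w by rewrite cabs_gt0.
exists (- w^-2), (w^-3), (2 / cabs w ^+ 4), (cabs w / 2); split.
- by rewrite divr_gt0.
- by rewrite divr_ge0 // exprn_ge0 // cabs_ge0.
move=> h hh.
have lb : cabs w / 2 <= cabs (w + h).
  have := cabs_lerB w (- h); rewrite opprK cabsN; lra.
have wh : w + h != 0 by rewrite -cabs_gt0; apply: lt_le_trans lb; rewrite divr_gt0.
rewrite -[X in cabs X](_ : - (h ^+ 3 * (w ^+ 3 * (w + h))^-1) = _); last first.
  by field; rewrite w0 wh.
rewrite cabsN cabsM cabsX mulrC ler_wpM2r ?exprn_ge0 ?cabs_ge0 //.
rewrite cabsV cabsM cabsX invf_ple ?posrE ?mulr_gt0 ?exprn_gt0 ?divr_gt0 ?(lt_le_trans _ lb) ?divr_gt0 //.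
rewrite invf_div exprSr -mulrA ler_wpM2l ?exprn_ge0 ?cabs_ge0 //.
by rewrite invr_gt0 exprn_gt0.
Qed.

Lemma T3_X f w n : T3 f w -> T3 (fun v => f v ^+ n) w.
Proof.
move=> h; elim: n => [|n IH]; first exact: (T3_cst 1).
rewrite [X in T3 X](_ : _ = fun v => f v * f v ^+ n); first exact: T3M.
by apply/funext => v; rewrite exprS.
Qed.

Lemma T3_sum n (F : 'I_n -> C -> C) w :
  (forall i, T3 (F i) w) -> T3 (fun v => \sum_(i < n) F i v) w.
Proof.
elim: n F => [|n IH] F h.
  rewrite [X in T3 X](_ : _ = fun=> 0); first exact: T3_cst.
  by apply/funext => v; rewrite big_ord0.
rewrite [X in T3 X](_ : _ = fun w => F ord0 w + \sum_(i < n) F (lift ord0 i) w).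
  by apply: T3D => //; apply: IH.
by apply/funext => v; rewrite big_ord_recl.
Qed.

Lemma T3_lin f c u w : T3 f (c + u * w) -> T3 (fun v => f (c + u * v)) w.
Proof.
move=> [a [b [K [d [d0 K0 H]]]]].
have u1 : 0 < cabs u + 1 by rewrite ltr_wpDl ?cabs_ge0.
exists (a * u), (b * u ^+ 2), (K * cabs u ^+ 3), (d / (cabs u + 1)); split.
- exact: divr_gt0.
- by rewrite mulr_ge0 ?exprn_ge0 ?cabs_ge0.
move=> h; rewrite ltr_pdivlMr // => hh.
have := H (u * h); rewrite cabsM mulrDr addrA exprMn exprMn !mulrA; apply.
by apply: le_lt_trans hh; rewrite mulrC ler_wpM2l ?cabs_ge0 // lerDl.
Qed.

Lemma T3_ext f g w (r : R) : 0 < r -> (forall v, cabs (v - w) < r -> f v = g v) -> T3 f w -> T3 g w.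
Proof.
move=> r0 hfg [a [b [K [d [d0 K0 H]]]]].
exists a, b, K, (Num.min d r); split; rewrite ?lt_min ?d0 // => h.
rewrite lt_min => /andP[/H h1 h2].
by rewrite -!hfg ?subrr ?cabs0 // addrAC subrr add0r.
Qed.

Lemma T3_cts f w : T3 f w -> forall e : R, 0 < e ->
  exists2 del : R, 0 < del & forall v, cabs (v - w) < del -> cabs (f v - f w) < e.
Proof.
move=> [a [b [K [d [d0 K0 H]]]]] e e0.
set S := cabs a + cabs b + K + 1.
have S0 : 0 < S by rewrite ltr_wpDl // !addr_ge0 ?cabs_ge0.
exists (Num.min 1 (Num.min d (e / S))); first by rewrite !lt_min ltr01 d0 divr_gt0.
move=> v; rewrite !lt_min ltr_pdivlMr // => /and3P[h1 /H h2 h3].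
set h := v - w in h1 h2 h3; rewrite (_ : w + h = v) in h2; last by rewrite /h addrC subrK.
rewrite -[X in cabs X](_ : f v - (f w + a * h + b * h ^+ 2) + a * h + b * h ^+ 2 = _); last by ring.
set x := cabs h in h1 h2 h3 *.
have x0 : 0 <= x by exact: cabs_ge0.
have xn n : x ^+ n.+1 <= x by rewrite exprS ler_piMr // exprn_ile1 // ltW.
have hK : K * x ^+ 3 <= K * x by rewrite ler_wpM2l.
have hb : cabs (b * h ^+ 2) <= cabs b * x by rewrite cabsM cabsX ler_wpM2l ?cabs_ge0.
have ha : cabs (a * h) <= cabs a * x by rewrite cabsM.
have := cabsD (f v - (f w + a * h + b * h ^+ 2) + a * h) (b * h ^+ 2).
have := cabsD (f v - (f w + a * h + b * h ^+ 2)) (a * h).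
by move: h2 h3; rewrite /S; lra.
Qed.

End MVI.

(** * Maximum principle and Cauchy's inequality *)

(** X^n - 1 is separable because n is nonzero in K, so it has n distinct roots; n distinct n-th
    roots of unity in a field include a primitive one. *)
Lemma closed_field_prim_root (K : closedFieldType) n :
  (0 < n)%N -> n%:R != 0 :> K -> exists z : K, n.-primitive_root z.
Proof.
move=> n0 nK; have [rs] := closed_field_poly_normal ('X^n - 1 : {poly K}).
rewrite (monicP (monic_Xn_sub_1 _ n0)) scale1r => E.
suff /hasP[z _ hz] : has n.-primitive_root rs by exists z.
apply: has_prim_root => //.
- by apply/allP => z; rewrite -root_prod_XsubC -E.
- by rewrite -separable_prod_XsubC -E separable_Xn_sub_1.
- by have := size_prod_XsubC rs id; rewrite -E size_Xn_sub_1 // => -[->].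
Qed.

Section Cauchy.
Variable R : realType.
Local Notation C := (CC R).
Implicit Types (x y z w : C) (f g : C -> C).

(** Discs are pulled back along this map to closed subsets of a real square, which is compact as a
    product of segments. *)
Definition toC (p : R * R) : C := (p.1 +i* p.2)%C.

Lemma cabs_toC p q : cabs (toC p - toC q) <= `|p.1 - q.1| + `|p.2 - q.2|.
Proof. exact: cabs_ReIm. Qed.

Lemma toC_continuous (g : C -> R) (p : R * R) :
  (forall e : R, 0 < e -> exists2 del : R, 0 < del &
     forall v, cabs (v - toC p) < del -> `|g v - g (toC p)| < e) ->
  {for p, continuous (g \o toC)}.
Proof.
move=> H; apply/cvgrPdist_lt => e e0.
have [del del0 hd] := H e e0.
have d2 := divr_gt0 del0 (ltr0n R 2).
exists (ball p.1 (del / 2), ball p.2 (del / 2)).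
  by split; apply: nbhsx_ballx.
move=> [a b] /= [h1 h2]; rewrite distrC; apply: hd.
apply: (le_lt_trans (cabs_toC _ _)) => /=.
by move: h1 h2; rewrite /ball /= distrC (distrC p.2); lra.
Qed.

Lemma disc_max (u : C -> R) (rho : R) : 0 <= rho ->
  (forall z, cabs z <= rho -> forall e : R, 0 < e -> exists2 del : R, 0 < del &
     forall v, cabs (v - z) < del -> `|u v - u z| < e) ->
  exists2 z, cabs z <= rho & forall w, cabs w <= rho -> u w <= u z.
Proof.
move=> rho0 H.
pose D := [set p : R * R | cabs (toC p) <= rho].
have cD : closed D.
  rewrite (_ : D = (fun p => cabs (toC p)) @^-1` [set x | x <= rho]) //.
  apply: closed_comp; last exact: closed_le.
  move=> p _; apply: (@toC_continuous (@cabs R)) => e e0; exists e => // v hv.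
  rewrite ltr_norml; have := cabs_lerB (toC p) v; have := cabs_lerB v (toC p).
  by rewrite (cabs_distC (toC p)); lra.
have kD : compact D.
  apply: (subclosed_compact cD (B := `[- rho, rho] `*` `[- rho, rho])).
    by apply: compact_setX; apply: segment_compact.
  move=> [a b]; rewrite /D /= => hab; rewrite !in_itv /= -!ler_norml; split.
    by apply: le_trans hab; exact: (@cabs_Re R (toC (a, b))).
  by apply: le_trans hab; exact: (@cabs_Im R (toC (a, b))).
have D0 : D !=set0 by exists (0, 0); change (cabs (0 : C) <= rho); rewrite cabs0.
have uD : {within D, continuous (u \o toC)}.
  apply: continuous_in_subspaceT => p; rewrite inE => pD.
  by apply: toC_continuous; apply: H.
have [p pD pm] := compact_EVT_max D0 kD uD.
exists (toC p); first by rewrite inE in pD.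
case=> a b wr; have /= := pm (a, b); apply.
by rewrite inE.
Qed.

Lemma cabs_sqrD x y : cabs (x + y) ^+ 2 = cabs x ^+ 2 + 2 * cdot x y + cabs y ^+ 2.
Proof. by rewrite !cabs_sqr; case: x y => [a b] [c d]; rewrite /cdot /=; ring. Qed.

Lemma cdot_sum4 z (s : R) : 
  cdot z (rC s) + cdot z (rC s * 'i%C) + cdot z (- rC s) + cdot z (- (rC s * 'i%C)) = 0.
Proof. by rewrite !cdotNr; ring. Qed.

(* At an interior maximum z of |H|^2 + eps |w|^2, averaging over z + h with
   h = s, is, -s, -is cancels the terms in h and h^2: the average exceeds the
   maximum by eps s^2 up to an O(s^3). *)
Lemma T3_max_center (H : C -> C) (rho B : R) : 0 < rho ->
  (forall w, cabs w <= rho -> T3 H w) ->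
  (forall w, cabs w = rho -> cabs (H w) <= B) -> cabs (H 0) <= B.
Proof.
move=> rho0 HT HB; rewrite leNgt; apply/negP => lt.
have B0 : 0 <= B by apply: le_trans (HB (rC rho) _); rewrite ?cabs_ge0 // cabs_rC gtr0_norm.
have gap : 0 < cabs (H 0) ^+ 2 - B ^+ 2.
  by rewrite subr_gt0 ltrXn2r ?nnegrE ?cabs_ge0.
(* Chosen so that eps rho^2 is half the gap |H 0|^2 - B^2. On the circle the perturbed function then
   stays below its value at 0, so its maximum is interior. *)
pose eps := (cabs (H 0) ^+ 2 - B ^+ 2) / 2 / rho ^+ 2.
have eps0 : 0 < eps by rewrite !divr_gt0 // exprn_gt0.
have epsr : eps * rho ^+ 2 = (cabs (H 0) ^+ 2 - B ^+ 2) / 2.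
  by rewrite divfK // expf_neq0 // gt_eqF.
pose u w := cabs (H w) ^+ 2 + eps * cabs w ^+ 2.
have sqc (K : C -> C) w : (forall e : R, 0 < e ->
    exists2 del : R, 0 < del & forall v, cabs (v - w) < del -> cabs (K v - K w) < e) ->
  forall e : R, 0 < e ->
    exists2 del : R, 0 < del & forall v, cabs (v - w) < del -> `|cabs (K v) ^+ 2 - cabs (K w) ^+ 2| < e.
  move=> hK e e0; have S0 : 0 < 2 * cabs (K w) + 1 by rewrite ltr_wpDl ?mulr_ge0 ?cabs_ge0.
  have m0 : 0 < Num.min 1 (e / (2 * cabs (K w) + 1)) by rewrite lt_min ltr01 divr_gt0.
  have [del d0 hd] := hK _ m0; exists del => // v /hd; rewrite lt_min ltr_pdivlMr // => /andP[h1 h2].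
  rewrite subr_sqr normrM.
  have n1 : `|cabs (K v) - cabs (K w)| <= cabs (K v - K w).
    rewrite ler_norml; have := cabs_lerB (K w) (K v); have := cabs_lerB (K v) (K w).
    by rewrite (cabs_distC (K w)); lra.
  have n2 : `|cabs (K v) + cabs (K w)| <= 2 * cabs (K w) + 1.
    rewrite ger0_norm ?addr_ge0 ?cabs_ge0 //; have := cabs_lerB (K v) (K w); lra.
  by apply: le_lt_trans h2; rewrite ler_pM.
have [z zr zm] : exists2 z, cabs z <= rho & forall w, cabs w <= rho -> u w <= u z.
  apply: disc_max => [|z zr e e0]; first exact: ltW.
  have [d1 d10 h1] := sqc _ _ (T3_cts (HT z zr)) _ (divr_gt0 e0 (ltr0n _ 2)).
  have idc (e' : R) : 0 < e' -> exists2 del : R, 0 < del & forall v, cabs (v - z) < del -> cabs (id v - id z) < e'.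
    by move=> e'0; exists e'.
  have e2 : 0 < e / 2 / eps by apply: divr_gt0 => //; exact: divr_gt0.
  have [d2 d20 h2] := sqc id z idc _ e2.
  exists (Num.min d1 d2); first by rewrite lt_min d10.
  move=> v; rewrite lt_min => /andP[/h1 g1 /h2].
  rewrite ltr_pdivlMr // => g2.
  rewrite /u (_ : _ + _ - _ = (cabs (H v) ^+ 2 - cabs (H z) ^+ 2) + (cabs v ^+ 2 - cabs z ^+ 2) * eps); last by ring.
  apply: (le_lt_trans (ler_normD _ _)); rewrite normrM (gtr0_norm eps0) /=; lra.
have zlt : cabs z < rho.
  rewrite lt_def zr andbT; apply/eqP => zE; have := zm 0; rewrite cabs0 /u cabs0 -zE => /(_ (ltW rho0)).
  have := HB z (esym zE); rewrite expr0n /= mulr0 addr0 zE in epsr *; rewrite epsr => h1.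
  have : cabs (H z) ^+ 2 <= B ^+ 2 by rewrite lerXn2r ?nnegrE ?cabs_ge0.
  lra.
have [a [b [K [del [del0 K0 hd]]]]] := HT z zr.
set h0 := cabs (H z); have h00 : 0 <= h0 by exact: cabs_ge0.
have Q0 : 0 < 2 * h0 * K + 1 by rewrite ltr_wpDl // !mulr_ge0.
(* Three constraints: the expansion at z is valid, z + h stays in the disc, and the cubic error 2 |H
   z| K s^3 falls below the gain eps s^2. *)
pose s := Num.min (del / 2) (Num.min ((rho - cabs z) / 2) (eps / 2 / (2 * h0 * K + 1))).
have rz : 0 < rho - cabs z by rewrite subr_gt0.
have e2 : 0 < eps / 2 by rewrite divr_gt0.
have s0 : 0 < s by rewrite !lt_min (divr_gt0 del0) // (divr_gt0 rz) // (divr_gt0 e2).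
have s1 : s <= del / 2 by rewrite /s ge_min lexx.
have s2 : s <= (rho - cabs z) / 2 by rewrite /s !ge_min lexx orbT.
have s3 : s * (2 * h0 * K + 1) <= eps / 2 by rewrite -ler_pdivlMr // /s !ge_min lexx !orbT.
pose E h := H (z + h) - (H z + a * h + b * h ^+ 2).
have key h : cabs h = s -> h0 ^+ 2 + 2 * cdot (H z) (a * h + b * h ^+ 2 + E h) +
    eps * (cabs z ^+ 2 + 2 * cdot z h + s ^+ 2) <= u z.
  move=> hs; apply: le_trans (zm (z + h) _); last first.
    apply: (le_trans (cabsD _ _)); lra.
  rewrite /u cabs_sqrD hs lerD2r.
  have -> : H (z + h) = H z + (a * h + b * h ^+ 2 + E h) by rewrite /E; ring.
  by rewrite cabs_sqrD lerDl sqr_ge0.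
have Ele h : cabs h = s -> `|cdot (H z) (E h)| <= h0 * (K * s ^+ 3).
  move=> hs; apply: (le_trans (cdot_le _ _)); rewrite ler_wpM2l //.
  by rewrite -hs; apply: hd; lra.
have ci : cabs ('i%C : C) = 1 by rewrite /cabs /= expr0n expr1n /= add0r sqrtr1.
have a1 : cabs (rC s) = s by rewrite cabs_rC gtr0_norm.
have a2 : cabs (rC s * 'i%C : C) = s by rewrite cabsM ci mulr1.
have a3 : cabs (- rC s) = s by rewrite cabsN.
have a4 : cabs (- (rC s * 'i%C : C)) = s by rewrite cabsN.
have := key _ a1; have := key _ a2; have := key _ a3; have := key _ a4.
have := Ele _ a1; have := Ele _ a2; have := Ele _ a3; have := Ele _ a4.
rewrite !ler_norml !cdotDr.
have := cdot_sum4 z s.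
have i2 : ('i%C : C) ^+ 2 = -1 by exact: sqr_i.
have p1 : b * (rC s * 'i%C) ^+ 2 = - (b * rC s ^+ 2) by rewrite exprMn i2; ring.
rewrite !sqrrN !mulrN !p1 !cdotNr /u -/h0.
have S2 : 0 < s ^+ 2 by rewrite exprn_gt0.
have : s ^+ 2 * (2 * h0 * K * s) < s ^+ 2 * eps.
  rewrite ltr_pM2l //; lra.
have -> : s ^+ 2 * (2 * h0 * K * s) = 2 * (h0 * (K * s ^+ 3)) by ring.
nra.
Qed.

(** Orthogonality of the characters of Z/n: a geometric sum of ratio q = om^(k-p), with q^n = 1 and
    q different from 1 unless k = p, both exponents being below n. *)
Lemma prim_root_sum n (om : C) k p : n.-primitive_root om -> (k < n)%N -> (p < n)%N ->
  \sum_(j < n) (om ^+ j) ^- p * (om ^+ j) ^+ k = if k == p then n%:R else 0.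
Proof.
move=> hom kn pn; have om0 : om != 0 by rewrite (prim_root_eq0 hom) -lt0n (leq_ltn_trans _ kn).
pose q := om ^+ k / om ^+ p.
rewrite (eq_bigr (fun j : 'I_n => q ^+ j)); last first.
  by move=> j _; rewrite /q expr_div_n -!exprM mulrC (mulnC k) (mulnC p).
have [kp|kp] := eqVneq k p.
  rewrite (eq_bigr (fun=> 1)) ?sumr_const ?card_ord // => j _.
  by rewrite /q kp divff ?expr1n ?expf_neq0.
have q1 : q - 1 != 0.
  rewrite subr_eq0 /q; apply/negP => /eqP/(congr1 (fun t => t * om ^+ p)).
  rewrite divfK ?expf_neq0 // mul1r => /eqP.
  by rewrite (eq_prim_root_expr hom) !modn_small // (negPf kp).
apply: (mulfI q1); rewrite -subrX1 mulr0 /q expr_div_n -!exprM (mulnC k) (mulnC p) !exprM.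
by rewrite (prim_expr_order hom) !expr1n divr1 subrr.
Qed.

(* Averaging f (c + om^j z) om^(-jp) over the n-th roots of unity, n = p + 3,
   kills the Taylor terms of degree < n other than p, so the average divided by
   z^p extends to 0 with value fs p c / p! and a cubic remainder there. *)
Lemma cauchy_ineq c (r rho M : R) (fs : nat -> C -> C) p : 0 < rho < r -> tower c r fs ->
  (forall w, cabs (w - c) <= rho -> cabs (fs 0%N w) <= M) ->
  cabs (fs p c) / (p`!)%:R * rho ^+ p <= M.
Proof.
move=> /andP[rho0 rr] tw hM; set n := (p + 3)%N.
have n0 : (0 < n)%N by rewrite /n addnS.
have nC : n%:R != 0 :> C by rewrite pnatr_eq0 -lt0n.
have [om hom] : exists om : C, n.-primitive_root om.
  exact: (@closed_field_prim_root R[i] n).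
have om0 : om != 0 by rewrite (prim_root_eq0 hom) -lt0n.
have om1 j : cabs (om ^+ j) = 1.
  rewrite cabsX; have : cabs om ^+ n = 1 by rewrite -cabsX (prim_expr_order hom) cabs1.
  by move/eqP; rewrite pexpr_eq1 ?cabs_ge0 // => /eqP ->; rewrite expr1n.
pose G z := n%:R^-1 * \sum_(j < n) (om ^+ j) ^- p * fs 0%N (c + om ^+ j * z).
have GM z : cabs z <= rho -> cabs (G z) <= M.
  move=> zr; rewrite cabsM cabsV cabs_nat ler_pdivrMl ?ltr0n //.
  apply: (le_trans (cabs_sum _ _ _)).
  rewrite mulr_natl -[n in X in _ <= X]card_ord -sumr_const; apply: ler_sum => j _.
  rewrite cabsM cabsV cabsX om1 expr1n invr1 mul1r; apply: hM.
  by rewrite addrAC subrr add0r cabsM om1 mul1r.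
pose ap := fs p c / (p`!)%:R.
pose H z := if z == 0 then ap else G z / z ^+ p.
have r0 : 0 < r by exact: lt_trans rr.
have GT z : cabs z <= rho -> T3 G z.
  move=> zr; apply: T3M; first exact: T3_cst.
  apply: T3_sum => j; apply: T3M; first exact: T3_cst.
  apply: T3_lin; apply: tower_T3 tw _.
  rewrite addrAC subrr add0r cabsM om1 mul1r; exact: le_lt_trans rr.
have HT z : cabs z <= rho -> T3 H z.
  move=> zr; have [->|z0] := eqVneq z 0; last first.
    have cz : 0 < cabs z by rewrite cabs_gt0.
    (* The disc of radius |z| about z avoids 0, so there the case distinction in [H] disappears. *)
    apply: (@T3_ext _ (fun v => G v * (v^-1) ^+ p) _ _ _ cz).
      move=> v; rewrite /H; have [->|_ _] := eqVneq v 0; last by rewrite exprVn.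
      by rewrite sub0r cabsN ltxx.
    by apply: T3M; [exact: GT|apply: T3_X; exact: T3_inv].
  have [K [del [del0 K0 hT]]] := tower_taylor n r0 tw.
  exists 0, 0, K, del; split => // h hh; rewrite add0r !mul0r !addr0 /H eqxx.
  have [->|h0] := eqVneq h 0; first by rewrite subrr cabs0 mulr_ge0 ?exprn_ge0.
  have ch : 0 < cabs h by rewrite cabs_gt0.
  have -> : G h / h ^+ p - ap = (G h - ap * h ^+ p) / h ^+ p.
    by rewrite mulrBl mulfK ?expf_neq0.
  rewrite cabsM cabsV cabsX ler_pdivrMr ?exprn_gt0 // -[leRHS]mulrA -exprD addnC -/n.
  (* By orthogonality the target is the same average, taken over Taylor polynomials instead of
     values. The difference is thus an average of Taylor remainders, all at distance |h| from c. *)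
  have -> : ap * h ^+ p = n%:R^-1 * \sum_(j < n) (om ^+ j) ^- p * \sum_(k < n) fs k c / k`!%:R * (c + om ^+ j * h - c) ^+ k.
    under eq_bigr do rewrite mulr_sumr.
    rewrite exchange_big /=.
    under eq_bigr => k _.
      rewrite (eq_bigr (fun j : 'I_n => ((om ^+ j) ^- p * (om ^+ j) ^+ k) * (fs k c / k`!%:R * h ^+ k))); last first.
        by move=> j _; rewrite addrAC subrr add0r exprMn; ring.
      rewrite -mulr_suml prim_root_sum ?ltn_ord //; last by rewrite /n -[X in (X < _)%N]addn0 ltn_add2l.
      over.
    have pn : (p < n)%N by rewrite /n -[X in (X < _)%N]addn0 ltn_add2l.
    rewrite (bigD1 (Ordinal pn)) //= eqxx big1 ?addr0 ?mulKf //.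
    by move=> k /negPf; rewrite -val_eqE /= => ->; rewrite mul0r.
  rewrite /G -mulrBr -sumrB cabsM cabsV cabs_nat ler_pdivrMl ?ltr0n //.
  apply: (le_trans (cabs_sum _ _ _)).
  rewrite mulr_natl -[n in X in _ <= X]card_ord -sumr_const; apply: ler_sum => j _.
  rewrite -mulrBr cabsM cabsV cabsX om1 expr1n invr1 mul1r.
  have hj : cabs (c + om ^+ j * h - c) = cabs h by rewrite addrAC subrr add0r cabsM om1 mul1r.
  rewrite card_ord -[in leRHS]hj; apply: hT; by rewrite hj.
have := T3_max_center rho0 HT (B := M / rho ^+ p).
rewrite /H eqxx /ap cabsM cabsV cabs_nat => hB.
rewrite -ler_pdivlMr ?exprn_gt0 //; apply: hB => w wr.
have /negPf -> : w != 0 by rewrite -cabs_gt0 wr.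
by rewrite cabsM cabsV cabsX wr ler_wpM2r ?invr_ge0 ?exprn_ge0 ?(ltW rho0) // GM // wr.
Qed.

End Cauchy.

(** * Double power series *)

Section PowerSeries.
Variable R : realType.
Local Notation C := (CC R).
Implicit Types (x y w h l : C) (s : nat -> C) (F G : C * C -> C) (z : C * C).

Lemma cvg_cabs_le s l (B : R) : s @ \oo --> l -> (forall N, cabs (s N) <= B) -> cabs l <= B.
Proof.
move=> sl sB; apply/ler_addgt0Pr => e e0.
have [N _ /(_ N (leqnn _)) H] := (ccvgP _ _).1 sl _ e0.
rewrite -[l](subrK (s N)) (le_trans (cabsD _ _)) // addrC lerD //; exact: ltW.
Qed.

Lemma cvg_cabs0 s s' l (A : nat -> R) : s @ \oo --> l ->
  (forall N, cabs (s' N - s N) <= A N) -> A @ \oo --> (0 : R) -> s' @ \oo --> l.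
Proof.
move=> sl sA A0; apply/ccvgP => e e0; have e2 : 0 < e / 2 by rewrite divr_gt0.
have h1 : \forall t \near \oo, cabs (l - s t) < e / 2 by apply: (ccvgP _ _).1 e2.
move/cvgrPdist_lt : A0 => /(_ _ e2) h2.
apply: filterS2 h1 h2 => N; rewrite sub0r normrN => h1 h2.
have := cabs_tri (s N) l (s' N); have := sA N; rewrite (cabs_distC (s' N)).
have := ler_norm (A N); lra.
Qed.

(** Both A and A + u are nondecreasing and bounded, hence convergent, and u is their difference. *)
Lemma real_cvg_dom (u A : nat -> R) (M : R) :
  (forall N, `|u N.+1 - u N| <= A N.+1 - A N) -> (forall N, `|u N| <= A N) ->
  (forall N, A N <= M) -> cvgn u.
Proof.
move=> du uA AM.
have nd (v : nat -> R) (K : R) : (forall N, v N <= v N.+1) -> (forall N, v N <= K) -> cvgn v.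
  move=> vS vK; apply: nondecreasing_is_cvgn.
    by apply/nondecreasing_seqP.
  by exists K => _ [N _ <-].
have cA : cvgn A.
  by apply: (nd _ M) => // N; have := du N; have := normr_ge0 (u N.+1 - u N); lra.
have cS : cvgn (A + u).
  apply: (nd _ (M + M)) => N; rewrite !fctE.
    by have := du N; rewrite ler_norml; lra.
  by have := uA N; have := AM N; rewrite ler_norml; lra.
rewrite (_ : u = (A + u) - A); first exact: is_cvgB.
by apply/funext => N; rewrite /= addrAC subrr add0r.
Qed.

Lemma increment_cvg0 (A : nat -> R) (M : R) :
  (forall N, A N <= A N.+1) -> (forall N, A N <= M) -> (fun N => A N.+1 - A N) @ \oo --> (0 : R).
Proof.
move=> AS AM; have cA : cvgn A.
  by apply: nondecreasing_is_cvgn; [apply/nondecreasing_seqP|exists M => _ [N _ <-]].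
rewrite -(subrr (limn A)); apply: cvgB => //.
by rewrite (cvg_shiftS A).
Qed.

Lemma complex_cvg_dom s (A : nat -> R) (M : R) :
  (forall N, cabs (s N.+1 - s N) <= A N.+1 - A N) -> (forall N, cabs (s N) <= A N) ->
  (forall N, A N <= M) -> exists l, s @ \oo --> l.
Proof.
move=> ds sA AM.
have ReB x y : complex.Re (x - y) = complex.Re x - complex.Re y by case: x y => [? ?] [? ?].
have ImB x y : complex.Im (x - y) = complex.Im x - complex.Im y by case: x y => [? ?] [? ?].
have /cvg_ex[/= a ca] : cvgn (fun N => complex.Re (s N)).
  apply: (@real_cvg_dom _ A M) => // N; rewrite -?ReB; exact: le_trans (cabs_Re _) _.
have /cvg_ex[/= b cb] : cvgn (fun N => complex.Im (s N)).
  apply: (@real_cvg_dom _ A M) => // N; rewrite -?ImB; exact: le_trans (cabs_Im _) _.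
exists (a +i* b)%C; apply/ccvgP => e e0; have e2 : 0 < e / 2 by rewrite divr_gt0.
move/cvgrPdist_lt : ca => /(_ _ e2) ca; move/cvgrPdist_lt : cb => /(_ _ e2) cb.
apply: filterS2 ca cb => N h1 h2; apply: (le_lt_trans (cabs_ReIm _)).
rewrite ReB ImB /=; lra.
Qed.

(* dsum are the square partial sums of analytic_D2; rsum are needed because
   differentiating in the first variable shifts the row index by one. *)
Definition dsum (V : nmodType) (c : nat -> nat -> V) N := \sum_(m < N) \sum_(n < N) c m n.
Definition rsum (V : nmodType) (c : nat -> nat -> V) N := \sum_(m < N.+1) \sum_(n < N) c m n.

Lemma rsumE (V : nmodType) (c : nat -> nat -> V) N :
  rsum c N = dsum c N + \sum_(n < N) c N n.
Proof. by rewrite /rsum big_ord_recr. Qed.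

Lemma dsumS (V : nmodType) (c : nat -> nat -> V) N :
  dsum c N.+1 = rsum c N + \sum_(m < N.+1) c m N.
Proof.
by rewrite /dsum /rsum -big_split; apply: eq_bigr => m _; rewrite big_ord_recr.
Qed.

Lemma dsum_incr (V : zmodType) (c : nat -> nat -> V) N :
  dsum c N.+1 - dsum c N = \sum_(n < N) c N n + \sum_(m < N.+1) c m N.
Proof. by apply/eqP; rewrite subr_eq dsumS rsumE [eqbRHS]addrC addrA. Qed.

(** * Absolutely dominated double series *)

Section Dominated.
Variables (c : nat -> nat -> C) (al : nat -> nat -> R) (M : R).
Hypothesis cal : forall m n, cabs (c m n) <= al m n.
Hypothesis alM : forall N, dsum al N <= M.

Lemma dom_ge0 m n : 0 <= al m n. Proof. exact: le_trans (cabs_ge0 _) (cal m n). Qed.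

Lemma rsum_diff N : cabs (rsum c N - dsum c N) <= dsum al N.+1 - dsum al N.
Proof.
rewrite rsumE addrAC subrr add0r dsum_incr.
apply: (le_trans (cabs_sum _ _ _)); rewrite -[leLHS]addr0 lerD //.
  exact: ler_sum.
by apply: sumr_ge0 => m _; exact: dom_ge0.
Qed.

Lemma dsum_diff N : cabs (dsum c N.+1 - dsum c N) <= dsum al N.+1 - dsum al N.
Proof.
rewrite !dsum_incr.
apply: (le_trans (cabsD _ _)); apply: lerD;
  by apply: (le_trans (cabs_sum _ _ _)); exact: ler_sum.
Qed.

Lemma cabs_dsum N : cabs (dsum c N) <= dsum al N.
Proof.
apply: (le_trans (cabs_sum _ _ _)); apply: ler_sum => m _.
by apply: (le_trans (cabs_sum _ _ _)); apply: ler_sum => n _.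
Qed.

Lemma dsum_cvg : exists l, dsum c @ \oo --> l.
Proof. exact: complex_cvg_dom dsum_diff cabs_dsum alM. Qed.

(** The extra row is dominated by the next increment of the bounded monotone sums of [al], and these
    increments tend to 0. *)
Lemma rsum_cvg l : dsum c @ \oo --> l -> rsum c @ \oo --> l.
Proof.
move=> cl; apply: (cvg_cabs0 cl rsum_diff); apply: (increment_cvg0 _ alM) => N.
by rewrite -subr_ge0; apply: le_trans (dsum_diff N); exact: cabs_ge0.
Qed.

Lemma cabs_rsum N : cabs (rsum c N) <= M.
Proof.
apply: le_trans (alM N.+1); rewrite dsumS.
apply: (@le_trans _ _ (rsum al N)).
  apply: (le_trans (cabs_sum _ _ _)); apply: ler_sum => m _.
  by apply: (le_trans (cabs_sum _ _ _)); apply: ler_sum => n _.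
by rewrite lerDl; apply: sumr_ge0 => m _; exact: dom_ge0.
Qed.

End Dominated.

(** These are the termwise bounds of the binomial expansion with |h| / sg <= 1, where 2^m is the sum
    of the binomial coefficients. Being geometric in m, they can be summed against coefficients that
    converge absolutely at radius 2 sg. *)
Lemma expr_diff_bound (sg : R) x h m : 0 < sg -> cabs x <= sg -> cabs h <= sg ->
  cabs ((x + h) ^+ m - x ^+ m) <= cabs h / sg * ((2 * sg) ^+ m - sg ^+ m) /\
  cabs ((x + h) ^+ m - x ^+ m - h * (m%:R * x ^+ m.-1)) <= (cabs h / sg) ^+ 2 * (2 * sg) ^+ m.
Proof.
move=> sg0 hx hh; set q := cabs h / sg.
have q0 : 0 <= q by rewrite divr_ge0 ?cabs_ge0 ?(ltW sg0).
have hq : cabs h = q * sg by rewrite /q divfK ?gt_eqF.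
have s2 : 0 <= 2 * sg by rewrite mulr_ge0 ?(ltW sg0).
elim: m => [|m [IH1 IH2]].
  rewrite !expr0 !subrr !mulr0 mul0r mulr0 subrr cabs0; split => //.
  by rewrite mulr1 exprn_ge0.
have S0 : 0 <= sg ^+ m by rewrite exprn_ge0 ?(ltW sg0).
have P0 : sg ^+ m <= (2 * sg) ^+ m by rewrite lerXn2r ?nnegrE ?(ltW sg0) //; lra.
split.
  rewrite (_ : _ - _ = x * ((x + h) ^+ m - x ^+ m) + h * (x + h) ^+ m); last by rewrite !exprS; ring.
  apply: (le_trans (cabsD _ _)); rewrite !cabsM.
  have B1 : cabs ((x + h) ^+ m) <= (2 * sg) ^+ m.
    rewrite cabsX lerXn2r ?nnegrE ?cabs_ge0 //.
    by apply: (le_trans (cabsD _ _)); lra.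
  have E1 : cabs x * cabs ((x + h) ^+ m - x ^+ m) <= sg * (q * ((2 * sg) ^+ m - sg ^+ m)).
    by rewrite ler_pM ?cabs_ge0.
  have E2 : cabs h * cabs ((x + h) ^+ m) <= q * sg * (2 * sg) ^+ m.
    by rewrite hq ler_wpM2l // mulr_ge0 ?(ltW sg0).
  by rewrite !exprS; lra.
rewrite (_ : _ - _ = x * ((x + h) ^+ m - x ^+ m - h * (m%:R * x ^+ m.-1)) + h * ((x + h) ^+ m - x ^+ m)); last first.
  rewrite /= !exprS -(natr1 m); case: m {IH1 IH2 S0 P0} => [|m] /=; first by rewrite !expr0; ring.
  by rewrite !exprS; ring.
apply: (le_trans (cabsD _ _)); rewrite !cabsM.
have E1 : cabs x * cabs ((x + h) ^+ m - x ^+ m - h * (m%:R * x ^+ m.-1)) <= sg * (q ^+ 2 * (2 * sg) ^+ m).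
  by rewrite ler_pM ?cabs_ge0.
have E2 : cabs h * cabs ((x + h) ^+ m - x ^+ m) <= q * sg * (q * ((2 * sg) ^+ m - sg ^+ m)).
  by rewrite hq ler_wpM2l // mulr_ge0 ?(ltW sg0).
have E3 : 0 <= q ^+ 2 * sg * sg ^+ m by apply: mulr_ge0 => //; apply: mulr_ge0; [exact: exprn_ge0|exact: ltW].
by rewrite !exprS; lra.
Qed.

Lemma natr_le_exp2 m : (m%:R : R) <= 2 ^+ m.
Proof. by rewrite -natrX ler_nat ltnW // ltn_expl. Qed.

Definition expansion (F : C * C -> C) (z0 : C * C) (r : R) (a : nat -> nat -> C) :=
  0 < r /\ forall z, cabs (z.1 - z0.1) < r -> cabs (z.2 - z0.2) < r ->
   (exists M : R, forall N, dsum (fun m n => cabs (a m n * (z.1 - z0.1) ^+ m * (z.2 - z0.2) ^+ n)) N <= M) /\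
   dsum (fun m n => a m n * (z.1 - z0.1) ^+ m * (z.2 - z0.2) ^+ n) @ \oo --> F z.

(** With r = 4 sg and rho = 2 sg, absolute convergence at radius rho dominates everything: points
    and increments of size below sg keep z + h within rho, and the factor m + 1 produced by
    differentiation is absorbed by 2^(m+1). *)
Lemma expansion_dz1 F z0 r a : expansion F z0 r a ->
  (forall z, cabs (z.1 - z0.1) < r / 4 -> cabs (z.2 - z0.2) < r / 4 ->
     cderiv (fun w => F (w, z.2)) z.1 (dz1 F z)) /\
  expansion (dz1 F) z0 (r / 4) (fun m n => (m.+1)%:R * a m.+1 n).
Proof.
move=> [r0 hF]; set sg := r / 4; have sg0 : 0 < sg by rewrite divr_gt0.
have r4 : r = 4 * sg by rewrite /sg; field.
clearbody sg.
set rho := 2 * sg; have rho0 : 0 < rho by rewrite mulr_gt0.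
pose al m n := cabs (a m n) * rho ^+ m * rho ^+ n.
have al0 m n : 0 <= al m n by rewrite /al !mulr_ge0 ?cabs_ge0 ?exprn_ge0 ?(ltW rho0).
(* The hypothesis at the single point z0 + (rho, rho), where both coordinate differences have
   modulus rho, bounds the whole dominating series. *)
have [M alM] : exists M, forall N, dsum al N <= M.
  have [||[M hM] _] := hF (z0.1 + rC rho, z0.2 + rC rho).
  - rewrite /= addrAC subrr add0r cabs_rC gtr0_norm // r4 /rho; lra.
  - rewrite /= addrAC subrr add0r cabs_rC gtr0_norm // r4 /rho; lra.
  exists M => N; rewrite -[leLHS](_ : dsum (fun m n => cabs (a m n * (z0.1 + rC rho - z0.1) ^+ m * (z0.2 + rC rho - z0.2) ^+ n)) N = _) //.
  apply: eq_bigr => m _; apply: eq_bigr => n _.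
  by rewrite !(addrAC _ (rC rho)) !subrr !add0r !cabsM !cabsX !cabs_rC gtr0_norm.
have M0 : 0 <= M by have := alM 0%N; rewrite /dsum big_ord0.
pose al' m n := al m.+1 n / sg.
have al'M N : dsum al' N <= M / sg.
  have : dsum al N.+1 <= M by [].
  rewrite /dsum /al' big_ord_recl /= => h.
  under eq_bigr do rewrite -mulr_suml.
  rewrite -mulr_suml ler_wpM2r ?invr_ge0 ?(ltW sg0) //.
  apply: le_trans h; rewrite -[leLHS]add0r lerD //; first exact: sumr_ge0.
  apply: ler_sum => m _; rewrite big_ord_recr /= lerDl; exact: al0.
pose b m n := (m.+1)%:R * a m.+1 n.
have bal x y m n : cabs x < sg -> cabs y < sg -> cabs (b m n * x ^+ m * y ^+ n) <= al' m n.
  move=> hx hy; rewrite /b /al' /al !cabsM cabs_nat !cabsX.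
  have X1 : cabs x ^+ m <= sg ^+ m by rewrite lerXn2r ?nnegrE ?cabs_ge0 ?(ltW sg0) ?(ltW hx).
  have Y1 : cabs y ^+ n <= rho ^+ n.
    rewrite lerXn2r ?nnegrE ?cabs_ge0 ?(ltW rho0) //; rewrite /rho; lra.
  have Z1 : (m.+1)%:R * sg ^+ m <= rho ^+ m.+1 / sg.
    rewrite ler_pdivlMr // -[leLHS]mulrA -exprSr /rho (exprMn _ 2 sg).
    rewrite ler_wpM2r ?exprn_ge0 ?(ltW sg0) //.
    exact: natr_le_exp2.
  have A0 : 0 <= cabs (a m.+1 n) by exact: cabs_ge0.
  have -> : cabs (a m.+1 n) * rho ^+ m.+1 * rho ^+ n / sg = cabs (a m.+1 n) * (rho ^+ m.+1 / sg) * rho ^+ n by ring.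
  rewrite ler_pM ?mulr_ge0 ?exprn_ge0 ?cabs_ge0 //.
  rewrite mulrAC mulrC ler_wpM2l //; apply: le_trans Z1; rewrite ler_wpM2l //.
have main z : cabs (z.1 - z0.1) < sg -> cabs (z.2 - z0.2) < sg ->
  cderiv (fun w => F (w, z.2)) z.1 (dz1 F z) /\
  dsum (fun m n => b m n * (z.1 - z0.1) ^+ m * (z.2 - z0.2) ^+ n) @ \oo --> dz1 F z.
  move=> hx hy; set x := z.1 - z0.1 in hx *; set y := z.2 - z0.2 in hy *.
  have [g hg] := dsum_cvg (fun m n => bal x y m n hx hy) al'M.
  suff cd : cderiv (fun w => F (w, z.2)) z.1 g.
    by rewrite /dz1 (cderiv_derive1 cd).
  have aal u m n : cabs u <= rho -> cabs (a m n * u ^+ m * y ^+ n) <= al m n.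
    move=> hu; rewrite /al !cabsM !cabsX !ler_pM ?mulr_ge0 ?exprn_ge0 ?cabs_ge0 //.
      by rewrite lerXn2r ?nnegrE ?cabs_ge0 ?(ltW rho0).
    rewrite lerXn2r ?nnegrE ?cabs_ge0 ?(ltW rho0) //; rewrite /rho; lra.
  have rc u : cabs (u - z0.1) <= rho -> rsum (fun m n => a m n * (u - z0.1) ^+ m * y ^+ n) @ \oo --> F (u, z.2).
    move=> hu; apply: (rsum_cvg (fun m n => aal _ m n hu) alM).
    have [] := hF (u, z.2) _ _ => //=; first by move: hu; rewrite r4 /rho; lra.
    by move: hy; rewrite -/y r4; lra.
  move=> e e0.
  have M1 : 0 < M + 1 by lra.
  (* The remainder will be bounded by (|h| / sg)^2 M, which is at most e |h| as soon as |h| (M + 1)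
     <= e sg^2. *)
  exists (Num.min sg (e * sg ^+ 2 / (M + 1))); first by rewrite lt_min sg0 divr_gt0 ?mulr_gt0 ?exprn_gt0.
  move=> h; rewrite lt_min ltr_pdivlMr // => /andP[h1 h2].
  have xh : cabs (z.1 + h - z0.1) <= rho.
    rewrite addrAC -/x; apply: (le_trans (cabsD _ _)); rewrite /rho; lra.
  have xr : cabs (z.1 - z0.1) <= rho by rewrite -/x /rho; lra.
  (* Rows 0 to N of F differentiate to rows 0 to N - 1 of the derived series. Pairing [rsum] with
     [dsum] therefore makes the difference one sum of termwise remainders [c]. *)
  have L : (fun N => rsum (fun m n => a m n * (z.1 + h - z0.1) ^+ m * y ^+ n) N -
             rsum (fun m n => a m n * (z.1 - z0.1) ^+ m * y ^+ n) N -
             dsum (fun m n => b m n * x ^+ m * y ^+ n) N * h) @ \oo --> F (z.1 + h, z.2) - F (z.1, z.2) - g * h.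
    apply: cvgB; last by apply: cvgMl.
    by apply: cvgB; apply: rc.
  apply: (@le_trans _ _ ((cabs h / sg) ^+ 2 * M)); last first.
    rewrite exprMn exprVn mulrAC ler_pdivrMr ?exprn_gt0 //.
    have := cabs_ge0 h; move: h2; set t := cabs h; set S := sg ^+ 2 => h2 t0.
    have : t * (t * (M + 1)) <= t * (e * S) by apply: ler_wpM2l => //; exact: ltW.
    by have := mulr_ge0 t0 t0; rewrite expr2; lra.
  apply: (cvg_cabs_le L) => N.
  pose c m n := a m n * y ^+ n * ((x + h) ^+ m - x ^+ m - h * (m%:R * x ^+ m.-1)).
  rewrite (_ : _ - _ = rsum c N); last first.
    have -> : dsum (fun m n => b m n * x ^+ m * y ^+ n) N * h = rsum (fun m n => a m n * y ^+ n * (h * (m%:R * x ^+ m.-1))) N.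
      rewrite /rsum big_ord_recl /= big1 ?add0r; last by move=> i _; rewrite mul0r !mulr0.
      rewrite /dsum mulr_suml; apply: eq_bigr => m _; rewrite mulr_suml; apply: eq_bigr => n _.
      by rewrite /b /bump /= add1n; ring.
    rewrite /rsum -!sumrB; apply: eq_bigr => m _; rewrite -!sumrB; apply: eq_bigr => n _.
    by rewrite /c (addrAC z.1 h) -/x; ring.
  apply: (@cabs_rsum c (fun m n => (cabs h / sg) ^+ 2 * al m n)).
    move=> m n; rewrite /c /al 2!cabsM cabsX.
    have [_ E] := expr_diff_bound m sg0 (ltW hx) (ltW h1).
    rewrite -/rho in E.
    rewrite mulrAC.
    have -> : (cabs h / sg) ^+ 2 * (cabs (a m n) * rho ^+ m * rho ^+ n) = cabs (a m n) * ((cabs h / sg) ^+ 2 * rho ^+ m) * rho ^+ n by ring.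
    rewrite !ler_pM ?mulr_ge0 ?exprn_ge0 ?cabs_ge0 //.
    rewrite lerXn2r ?nnegrE ?cabs_ge0 ?(ltW rho0) //; rewrite /rho; lra.
  move=> N'; rewrite /dsum.
  under eq_bigr do rewrite -mulr_sumr.
  by rewrite -mulr_sumr ler_wpM2l ?exprn_ge0 ?divr_ge0 ?cabs_ge0 ?(ltW sg0) //; apply: alM.
split; first by move=> z z1 z2; have [] := main z z1 z2.
split => // z z1 z2; have [_ mz] := main z z1 z2; split => //.
exists (M / sg) => N; apply: le_trans (al'M N).
apply: ler_sum => m _; apply: ler_sum => n _; exact: bal.
Qed.

Lemma dsum_tr (V : nmodType) (c : nat -> nat -> V) : dsum (fun m n => c n m) = dsum c.
Proof. by apply/funext => N; rewrite /dsum exchange_big. Qed.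

Definition swapF (F : C * C -> C) : C * C -> C := fun z => F (z.2, z.1).

Lemma expansion_swap F z0 r a : expansion F z0 r a ->
  expansion (swapF F) (z0.2, z0.1) r (fun m n => a n m).
Proof.
move=> [r0 h]; split => // z /= z1 z2; have [[M hM] hc] := h (z.2, z.1) z2 z1.
rewrite /= in hM hc.
have E : (fun m n => a n m * (z.1 - z0.2) ^+ m * (z.2 - z0.1) ^+ n) = (fun m n => a n m * (z.2 - z0.1) ^+ n * (z.1 - z0.2) ^+ m).
  by apply/funext => m; apply/funext => n; rewrite mulrAC.
split.
  exists M => N; rewrite -dsum_tr.
  have -> : (fun m n => cabs (a m n * (z.1 - z0.2) ^+ n * (z.2 - z0.1) ^+ m)) = fun m n => cabs (a m n * (z.2 - z0.1) ^+ m * (z.1 - z0.2) ^+ n).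
    by apply/funext => m; apply/funext => n; rewrite mulrAC.
  exact: hM.
by rewrite E (dsum_tr (fun m n => a m n * (z.2 - z0.1) ^+ m * (z.1 - z0.2) ^+ n)).
Qed.

Lemma expansion_dz2 F z0 r a : expansion F z0 r a ->
  (forall z, cabs (z.1 - z0.1) < r / 4 -> cabs (z.2 - z0.2) < r / 4 ->
     cderiv (fun w => F (z.1, w)) z.2 (dz2 F z)) /\
  expansion (dz2 F) z0 (r / 4) (fun m n => (n.+1)%:R * a m n.+1).
Proof.
move=> /expansion_swap/expansion_dz1[h1 h2]; split.
  by move=> z z1 z2; exact: (h1 (z.2, z.1)).
have := expansion_swap h2; rewrite /= -surjective_pairing.
by rewrite (_ : swapF _ = dz2 F) //; apply/funext => -[].
Qed.

Lemma expansion_center F z0 r a : expansion F z0 r a -> F z0 = a 0%N 0%N.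
Proof.
move=> [r0 /(_ z0)]; rewrite !subrr cabs0 => /(_ r0 r0)[_].
move=> h; apply: (cvg_unique _ h); first exact: norm_hausdorff.
apply/ccvgP => e e0; exists 1%N => // -[//|N] _.
rewrite /dsum big_ord_recl /= big_ord_recl /= !expr0 !mulr1.
rewrite big1 ?addr0; last by move=> i _; rewrite expr0n /= mulr0.
rewrite big1 ?addr0 ?subrr ?cabs0 // => i _.
by rewrite big1 // => j _; rewrite expr0n /= mulr0 mul0r.
Qed.

(** * Partial derivatives of analytic functions *)

Section Analytic.
Variable F : C * C -> C.
Hypothesis aF : analytic_D2 F.

Lemma analytic_dz1 : analytic_D2 (dz1 F).
Proof.
move=> z0 /aF [r [a /expansion_dz1[_ h]]].
by exists (r / 4), (fun m n => (m.+1)%:R * a m.+1 n).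
Qed.

Lemma analytic_dz2 : analytic_D2 (dz2 F).
Proof.
move=> z0 /aF [r [a /expansion_dz2[_ h]]].
by exists (r / 4), (fun m n => (n.+1)%:R * a m n.+1).
Qed.

Lemma analytic_cderiv1 z : D2 z -> cderiv (fun w => F (w, z.2)) z.1 (dz1 F z).
Proof.
move=> /aF [r [a /[dup] [[r0 _]] /expansion_dz1[h _]]].
by apply: h; rewrite subrr cabs0 divr_gt0.
Qed.

Lemma analytic_cderiv2 z : D2 z -> cderiv (fun w => F (z.1, w)) z.2 (dz2 F z).
Proof.
move=> /aF [r [a /[dup] [[r0 _]] /expansion_dz2[h _]]].
by apply: h; rewrite subrr cabs0 divr_gt0.
Qed.

(** Expand at z itself: after one differentiation in each variable, in either order, the constant
    coefficient is a 1 1. *)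
Lemma dz12_comm z : D2 z -> dz2 (dz1 F) z = dz1 (dz2 F) z.
Proof.
move=> /aF [r [a h]].
have [_ /expansion_dz2[_ /expansion_center ->]] := expansion_dz1 h.
by have [_ /expansion_dz1[_ /expansion_center ->]] := expansion_dz2 h.
Qed.

(** Mixed derivatives are known to agree on the bidisc alone; since it is open, such an equality may
    be differentiated again. *)
Lemma dz1_congr G z : (forall w : C * C, D2 w -> F w = G w) -> D2 z -> dz1 F z = dz1 G z.
Proof.
move=> FG Dz; have [z1 z2] := Dz; symmetry; apply: cderiv_derive1.
have r0 : 0 < 1 - cabs z.1 by rewrite subr_gt0.
apply: (cderiv_ext r0) (analytic_cderiv1 Dz) => w hw; apply: FG; split => //=.
by have := cabsD (w - z.1) z.1; rewrite subrK; lra.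
Qed.

End Analytic.

Lemma analytic_iter1 F p : analytic_D2 F -> analytic_D2 (iter p (@dz1 R) F).
Proof. by move=> aF; elim: p => [//|p IH]; exact: analytic_dz1. Qed.

Lemma analytic_iter2 F p : analytic_D2 F -> analytic_D2 (iter p (@dz2 R) F).
Proof. by move=> aF; elim: p => [//|p IH]; exact: analytic_dz2. Qed.

Lemma analytic_Fder F p q : analytic_D2 F -> analytic_D2 (Fder F p q).
Proof. by move=> aF; apply: analytic_iter1; exact: analytic_iter2. Qed.

(** [Fder] differentiates in the second variable first, so a further [dz2] has to be moved past p
    copies of [dz1]. *)
Lemma dz2_iter1 F p z : analytic_D2 F -> D2 z ->
  dz2 (iter p (@dz1 R) F) z = iter p (@dz1 R) (dz2 F) z.
Proof.
move=> aF; elim: p z => [//|p IH] z Dz /=.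
have ap := @analytic_iter1 F p aF.
rewrite (dz12_comm ap Dz); exact: (dz1_congr (analytic_dz2 ap) IH Dz).
Qed.

Lemma Fder_cderiv1 F p q z : analytic_D2 F -> D2 z ->
  cderiv (fun w => Fder F p q (w, z.2)) z.1 (Fder F p.+1 q z).
Proof. by move=> aF Dz; exact: (analytic_cderiv1 (analytic_Fder p q aF) Dz). Qed.

Lemma Fder_cderiv2 F p q z : analytic_D2 F -> D2 z ->
  cderiv (fun w => Fder F p q (z.1, w)) z.2 (Fder F p q.+1 z).
Proof.
move=> aF Dz; have := dz2_iter1 p (analytic_iter2 q aF) Dz.
rewrite -[X in _ = X]/(Fder F p q.+1 z) => <-.
exact: (analytic_cderiv2 (analytic_Fder p q aF) Dz).
Qed.

End PowerSeries.

(** * Growth along segments *)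

Section Gronwall.
Variable R : realType.
Local Notation C := (CC R).
Implicit Types (x y w h : C).

Lemma sum_continuous_for (I : Type) (s : seq I) (P : pred I) (F : I -> R -> R) (t : R) :
  (forall i, {for t, continuous (F i)}) ->
  {for t, continuous (fun u => \sum_(i <- s | P i) F i u)}.
Proof.
move=> cF; elim: s => [|i s IH].
  rewrite (_ : (fun u => _) = fun=> 0); first exact: cvg_cst.
  by apply/funext => u; rewrite big_nil.
case Pi : (P i).
  rewrite (_ : (fun u => _) = fun u => F i u + \sum_(i <- s | P i) F i u).
    by apply: cvgD; [exact: cF|exact: IH].
  by apply/funext => u; rewrite big_cons Pi.
rewrite (_ : (fun u => _) = fun u => \sum_(i <- s | P i) F i u) //.
by apply/funext => u; rewrite big_cons Pi.
Qed.

Lemma cabs_continuous_segment (f : C -> C) a b (t : R) d :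
  cderiv f (a + rC t * (b - a)) d ->
  {for t, continuous (fun u : R => cabs (f (a + rC u * (b - a))))}.
Proof.
move=> cf; apply/cvgrPdist_lt => e e0.
have [del del0 H] := cderiv_cts cf (divr_gt0 e0 (ltr0n _ 2)).
have b1 : 0 < cabs (b - a) + 1 by rewrite ltr_wpDl ?cabs_ge0.
have := nbhsx_ballx t _ (divr_gt0 del0 b1); apply: filterS => u.
rewrite /ball /= distrC ltr_pdivlMr // => hu.
have := H (a + rC u * (b - a)).
rewrite (_ : _ - (a + _) = rC (u - t) * (b - a)); last by rewrite rCD rCN; ring.
rewrite cabsM cabs_rC => /(_ _)hd; have {hd} : cabs (f (a + rC u * (b - a)) - f (a + rC t * (b - a))) <= e / 2.
  by apply: hd; apply: le_lt_trans hu; rewrite ler_wpM2l // lerDl.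
move=> hd; rewrite ltr_norml.
have := cabs_lerB (f (a + rC t * (b - a))) (f (a + rC u * (b - a))).
have := cabs_lerB (f (a + rC u * (b - a))) (f (a + rC t * (b - a))).
rewrite (cabs_distC (f (a + rC t * (b - a)))); lra.
Qed.

(* At a maximum point of S on the segment, the mean value inequality bounds that
   maximum by S a plus half of itself. *)
Lemma segment_doubling (I : finType) (P : pred I) (f g : I -> C -> C) (c : I -> R) a b (B : R) :
  let S w := \sum_(i | P i) c i * cabs (f i w) in
  let W t := a + rC t * (b - a) in
  (forall i, 0 < c i) ->
  (forall i t, 0 <= t <= 1 -> cderiv (f i) (W t) (g i (W t))) ->
  (forall i t, P i -> 0 <= t <= 1 -> c i * cabs (g i (W t)) <= B * S (W t)) ->
  0 <= B -> #|I|%:R * (B * cabs (b - a)) <= 1 / 2 ->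
  S b <= 2 * S a.
Proof.
move=> S W c0 fg gB B0 small.
have cS : {within `[0, 1], continuous (fun t : R => S (W t))}.
  apply: continuous_in_subspaceT => t; rewrite inE /= in_itv /= => t01.
  apply: sum_continuous_for => i; apply: cvgMl_tmp.
  exact: cabs_continuous_segment (fg i t t01).
have [t] := EVT_max ler01 cS; rewrite in_itv /= => t01 tmax.
have S0 w : 0 <= S w by apply: sumr_ge0 => i _; rewrite mulr_ge0 ?cabs_ge0 ?(ltW (c0 i)).
have Wle : cabs (W t - a) <= cabs (b - a).
  rewrite /W addrAC subrr add0r cabsM cabs_rC ger0_norm; last by case/andP: t01.
  by rewrite ler_piMl ?cabs_ge0 //; case/andP: t01.
have step i : P i -> c i * cabs (f i (W t)) <= c i * cabs (f i a) + B * S (W t) * cabs (b - a).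
  move=> Pi; have ci := c0 i.
  have : cabs (f i (W t) - f i a) <= (B * S (W t) / c i) * cabs (W t - a).
    (* The part of the segment from a to W t is again made of points W (u t), where the hypotheses
       on f and g hold. *)
    have key (u : R) : 0 <= u <= 1 -> a + rC u * (W t - a) = W (u * t) /\ 0 <= u * t <= 1.
      move=> /andP[u0 u1]; case/andP: t01 => t0 t1; split.
        by rewrite /W rCM; ring.
      by rewrite mulr_ge0 //= mulr_ile1.
    apply: (mean_value_ineq (df := g i)) => u /key[-> ut]; first exact: fg.
    rewrite ler_pdivlMr // mulrC; apply: le_trans (gB _ _ Pi ut) _.
    rewrite ler_wpM2l //; apply: tmax; by rewrite in_itv.
  have := cabsD (f i (W t) - f i a) (f i a); rewrite subrK => h1 h2.
  have h3 : B * S (W t) / c i * cabs (W t - a) <= B * S (W t) / c i * cabs (b - a).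
    by rewrite ler_wpM2l // divr_ge0 ?mulr_ge0 // ltW.
  have : c i * cabs (f i (W t)) <= c i * (cabs (f i a) + B * S (W t) / c i * cabs (b - a)).
    rewrite ler_pM2l //; lra.
  rewrite mulrDr (_ : c i * (B * S (W t) / c i * cabs (b - a)) = B * S (W t) * cabs (b - a)) //.
  by field; rewrite gt_eqF.
have Sle : S (W t) <= S a + #|I|%:R * (B * S (W t) * cabs (b - a)).
  apply: (@le_trans _ _ (\sum_(i | P i) (c i * cabs (f i a) + B * S (W t) * cabs (b - a)))).
    exact: ler_sum.
  rewrite big_split /= lerD // mulr_natl -sumr_const big_mkcond /=; apply: ler_sum => i _.
  by case: ifP => // _; rewrite !mulr_ge0 ?cabs_ge0.
have : #|I|%:R * (B * S (W t) * cabs (b - a)) <= S (W t) / 2.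
  rewrite (_ : _ * _ = #|I|%:R * (B * cabs (b - a)) * S (W t)); last by ring.
  by have := ler_wpM2r (S0 (W t)) small; lra.
have : S b <= S (W t).
  have := tmax 1; rewrite /W rC1 mul1r (addrC a) subrK; apply.
  by rewrite in_itv /= ler01 lexx.
lra.
Qed.

End Gronwall.

(** * Cauchy's inequality in two variables *)

Section Cauchy2.
Variable R : realType.
Local Notation C := (CC R).
Variable F : C * C -> C.
Hypothesis aF : analytic_D2 F.

(** One variable at a time: the inequality in the second variable bounds the q-th derivative
    uniformly for w in the first disc, and this bound serves as the maximum for the inequality in
    the first variable. *)
Lemma cauchy_ineq2 (z0 : C * C) (r1 r2 M : R) p q :
  D2 z0 -> 0 < r1 -> 0 < r2 -> cabs z0.1 + r1 < 1 -> cabs z0.2 + r2 < 1 ->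
  (forall z, polydisc z0 r1 r2 z -> cabs (F z) <= M) ->
  cabs (Fder F p q z0) / ((p`!)%:R * (q`!)%:R) * (r1 ^+ p * r2 ^+ q) <= M.
Proof.
move=> Dz r10 r20 h1 h2 hM.
have inD (x c : C) (s : R) : cabs (x - c) < s -> cabs c + s <= 1 -> cabs x < 1.
  by move=> xc cs; have := cabsD (x - c) c; rewrite subrK; lra.
have inD' (x c : C) (s : R) : cabs (x - c) <= s -> cabs c + s < 1 -> cabs x < 1.
  by move=> xc cs; have := cabsD (x - c) c; rewrite subrK; lra.
have B2 w : cabs (w - z0.1) <= r1 -> cabs (Fder F 0 q (w, z0.2)) <= M * (q`!)%:R / r2 ^+ q.
  move=> hw; have tw : tower z0.2 (1 - cabs z0.2) (fun k v => Fder F 0 k (w, v)).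
    move=> k v hv; apply: (@Fder_cderiv2 _ F 0 k (w, v) aF); split => /=.
      exact: inD' hw h1.
    by apply: inD hv _; rewrite addrC subrK.
  have rr : 0 < r2 < 1 - cabs z0.2 by rewrite r20 ltrBrDl.
  rewrite ler_pdivlMr ?exprn_gt0 // -ler_pdivrMr ?ltr0n ?fact_gt0 // mulrAC.
  have /= := @cauchy_ineq _ _ _ _ M _ q rr tw; apply.
  by move=> v hv; apply: hM; split.
have tw : tower z0.1 (1 - cabs z0.1) (fun k v => Fder F k q (v, z0.2)).
  move=> k v hv; apply: (@Fder_cderiv1 _ F k q (v, z0.2) aF); split => /=; last by case: Dz.
  by apply: inD hv _; rewrite addrC subrK.
have rr : 0 < r1 < 1 - cabs z0.1 by rewrite r10 ltrBrDl.
have := @cauchy_ineq _ _ _ _ _ _ p rr tw B2; rewrite -surjective_pairing => h.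
have q0 : 0 < (q`!)%:R :> R by rewrite ltr0n fact_gt0.
have rq : 0 < r2 ^+ q by rewrite exprn_gt0.
rewrite ler_pdivlMr // -ler_pdivrMr // in h.
apply: le_trans h; rewrite le_eqVlt; apply/orP; left; apply/eqP.
by field; rewrite !pnatr_eq0 -!lt0n !fact_gt0.
Qed.

End Cauchy2.

(** * Bounded index *)

Section Index.
Variables (R : realType) (beta : R).
Local Notation C := (CC R).
Variables (l1 l2 : C * C -> R) (F : C * C -> C).
Hypothesis beta1 : 1 < beta.
Hypothesis hl1 : forall z, D2 z -> beta / (1 - cabs z.1) < l1 z.
Hypothesis hl2 : forall z, D2 z -> beta / (1 - cabs z.2) < l2 z.
Hypothesis hQ : Q2 beta l1 l2.
Hypothesis aF : analytic_D2 F.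
Implicit Types (z w : C * C) (r : R).

Lemma beta_gt0 : 0 < beta. Proof. exact: lt_trans beta1. Qed.

Lemma weight_gt0 (l : C * C -> R) z : l = l1 \/ l = l2 -> D2 z -> 0 < l z.
Proof.
move=> hl Dz; have [z1 z2] := Dz.
have [->|->] := hl.
  by apply: lt_trans (hl1 Dz); rewrite divr_gt0 ?subr_gt0 ?beta_gt0.
by apply: lt_trans (hl2 Dz); rewrite divr_gt0 ?subr_gt0 ?beta_gt0.
Qed.

Lemma l1_gt0 z : D2 z -> 0 < l1 z. Proof. by apply: weight_gt0; left. Qed.
Lemma l2_gt0 z : D2 z -> 0 < l2 z. Proof. by apply: weight_gt0; right. Qed.

Lemma radius1_lt z : D2 z -> cabs z.1 + beta / l1 z < 1.
Proof.
move=> Dz; have [z1 _] := Dz; have := hl1 Dz.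
rewrite ltr_pdivrMr ?subr_gt0 // => h.
by rewrite -ltrBrDl ltr_pdivrMr ?l1_gt0 // mulrC.
Qed.

Lemma radius2_lt z : D2 z -> cabs z.2 + beta / l2 z < 1.
Proof.
move=> Dz; have [_ z1] := Dz; have := hl2 Dz.
rewrite ltr_pdivrMr ?subr_gt0 // => h.
by rewrite -ltrBrDl ltr_pdivrMr ?l2_gt0 // mulrC.
Qed.

Definition nbhd z0 := polydisc z0 (beta / l1 z0) (beta / l2 z0).

Lemma nbhd_D2 z0 z : D2 z0 -> nbhd z0 z -> D2 z.
Proof.
move=> Dz [h1 h2]; split.
  by have := radius1_lt Dz; have := cabsD (z.1 - z0.1) z0.1; rewrite subrK; lra.
by have := radius2_lt Dz; have := cabsD (z.2 - z0.2) z0.2; rewrite subrK; lra.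
Qed.

Lemma nbhd_sub z0 z (r1 r2 : R) : D2 z0 -> r1 <= beta -> r2 <= beta ->
  polydisc z0 (r1 / l1 z0) (r2 / l2 z0) z -> nbhd z0 z.
Proof.
move=> Dz h1 h2 [p1 p2]; split.
  by apply: (le_trans p1); rewrite ler_wpM2r // invr_ge0 ltW // l1_gt0.
by apply: (le_trans p2); rewrite ler_wpM2r // invr_ge0 ltW // l2_gt0.
Qed.

(** [Q2] is taken at the largest radii (beta, beta). The constant max(1, d, 1/c) merges the upper
    bound d and the lower bound c of the ratios into one symmetric estimate. *)
Lemma weight_comparable1 (l : C * C -> R) : l = l1 \/ l = l2 ->
  exists2 La : R, 1 <= La & forall z0 z, D2 z0 -> nbhd z0 z ->
    l z <= La * l z0 /\ l z0 <= La * l z.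
Proof.
move=> hl; have bb : 0 <= beta <= beta by rewrite lexx ltW ?beta_gt0.
have [H1 [_ H2]] := hQ bb bb hl.
have inratio z0 z : D2 z0 -> nbhd z0 z -> ratio_set l1 l2 l beta beta (l z / l z0)%:E.
  by move=> Dz nz; exists z0; split => //; exists z.
have [c c0 hc] : exists2 c : R, 0 < c & forall z0 z, D2 z0 -> nbhd z0 z -> c <= l z / l z0.
  case E : (lambda1 l1 l2 l beta beta) H1 => [c| |] // H1.
    exists c => // z0 z Dz nz; rewrite -lee_fin -E.
    by apply: ereal_inf_lbound; apply: inratio.
  (* The infimum could still be +oo; any actual ratio l z / l z0 then contradicts it. The value -oo
     of the supremum is treated alike below. *)
  exists 1 => // z0 z Dz nz.
  have : (lambda1 l1 l2 l beta beta <= (l z / l z0)%:E)%E.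
    by apply: ereal_inf_lbound; apply: inratio.
  by rewrite E.
have [d hd] : exists d : R, forall z0 z, D2 z0 -> nbhd z0 z -> l z / l z0 <= d.
  case E : (lambda2 l1 l2 l beta beta) H2 => [d| |] // H2.
    exists d => z0 z Dz nz; rewrite -lee_fin -E.
    by apply: ereal_sup_ubound; apply: inratio.
  exists 0 => z0 z Dz nz.
  have : ((l z / l z0)%:E <= lambda2 l1 l2 l beta beta)%E.
    by apply: ereal_sup_ubound; apply: inratio.
  by rewrite E.
exists (Num.max 1 (Num.max d c^-1)); first by rewrite le_max lexx.
move=> z0 z Dz nz; have l0 := weight_gt0 hl Dz; have lz := weight_gt0 hl (nbhd_D2 Dz nz).
have := hd _ _ Dz nz; rewrite ler_pdivrMr // => g1.
have := hc _ _ Dz nz; rewrite ler_pdivlMr // mulrC -ler_pdivlMr // mulrC => g2.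
split.
  by apply: (le_trans g1); rewrite ler_pM2r // !le_max lexx orbT.
by apply: (le_trans g2); rewrite ler_pM2r // !le_max lexx !orbT.
Qed.

Lemma weight_comparable : exists2 La : R, 1 <= La & forall z0 z, D2 z0 -> nbhd z0 z ->
  [/\ l1 z <= La * l1 z0, l1 z0 <= La * l1 z, l2 z <= La * l2 z0 & l2 z0 <= La * l2 z].
Proof.
have [a a1 ha] := weight_comparable1 (or_introl erefl).
have [b b1 hb] := weight_comparable1 (or_intror erefl).
exists (Num.max a b); first by rewrite le_max a1.
move=> z0 z Dz nz; have Dz' := nbhd_D2 Dz nz.
have [h1 h2] := ha _ _ Dz nz; have [h3 h4] := hb _ _ Dz nz.
split; [apply: (le_trans h1)|apply: (le_trans h2)|apply: (le_trans h3)|apply: (le_trans h4)];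
  by rewrite ler_pM2r ?le_max ?lexx ?orbT // ?l1_gt0 ?l2_gt0.
Qed.

Local Notation T := (Lterm l1 l2 F).

Definition index_max n z : R := \big[Num.max/0]_(k1 < n.+1)
      \big[Num.max/0]_(k2 < n.+1 | (k1 + k2 <= n)%N) T k1 k2 z.

Lemma Lterm_le_index_max n k1 k2 z : (k1 + k2 <= n)%N -> T k1 k2 z <= index_max n z.
Proof.
move=> kn; have k1n : (k1 < n.+1)%N by lia.
have k2n : (k2 < n.+1)%N by lia.
apply: le_trans (@le_bigmax _ _ _ 0 _ (Ordinal k1n)).
by apply: (@le_bigmax_cond _ _ _ 0 (Ordinal k2n)).
Qed.

Lemma index_max_le n z (B : R) : 0 <= B ->
  (forall k1 k2, (k1 + k2 <= n)%N -> T k1 k2 z <= B) -> index_max n z <= B.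
Proof.
move=> B0 h; apply: bigmax_le => // k1 _; apply: bigmax_le => // k2; exact: h.
Qed.

Lemma index_max_ge0 n z : 0 <= index_max n z.
Proof. exact: bigmax_ge_id. Qed.

Lemma index_max_mono n m z : (n <= m)%N -> index_max n z <= index_max m z.
Proof.
move=> nm; apply: index_max_le; first exact: index_max_ge0.
by move=> k1 k2 kn; apply: Lterm_le_index_max; lia.
Qed.

Lemma fact_gt0R k : 0 < (k`!)%:R :> R. Proof. by rewrite ltr0n fact_gt0. Qed.

Lemma Lterm_ge0 k1 k2 z : D2 z -> 0 <= T k1 k2 z.
Proof.
move=> Dz; rewrite /Lterm divr_ge0 ?cabs_ge0 // !mulr_ge0 ?ler0n ?exprn_ge0 // ltW //.
  exact: l1_gt0.
exact: l2_gt0.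
Qed.

(** Bernoulli's inequality and the archimedean property. *)
Lemma exists_exp_ge (x B : R) : 1 < x -> exists n : nat, B <= x ^+ n.
Proof.
move=> x1; have [n hn] : exists n : nat, B / (x - 1) <= n%:R.
  exists (Num.bound `|B / (x - 1)|).
  by apply: (le_trans (ler_norm _)); exact/ltW/archi_boundP/normr_ge0.
exists n; rewrite ler_pdivrMr ?subr_gt0 // in hn; apply: (le_trans hn).
have : 1 + n%:R * (x - 1) <= x ^+ n.
  elim: n {hn} => [|n IH]; first by rewrite mul0r addr0 expr0.
  rewrite exprS -natr1; have : x * (1 + n%:R * (x - 1)) <= x * x ^+ n.
    by rewrite ler_wpM2l //; lra.
  have : 0 <= n%:R * (x - 1) ^+ 2 by rewrite mulr_ge0 ?sqr_ge0.
  by rewrite expr2; lra.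
lra.
Qed.

(* Iterating the hypothesis along a segment enlarges the polydisc to radii
   beta / l_j(z0), where Cauchy's inequality gains a factor beta^-(p+q) with beta > 1. *)
Lemma bounded_index_of_local (r1 r2 : R) n0 (p0 : R) :
  0 < r1 <= beta -> 0 < r2 <= beta ->
  1 < p0 -> (forall z0, D2 z0 -> exists k10 k20 : nat, (k10 + k20 <= n0)%N /\
        forall (k1 k2 : nat) z, (k1 + k2 <= n0)%N ->
          polydisc z0 (r1 / l1 z0) (r2 / l2 z0) z ->
          T k1 k2 z <=
          p0 / ((k10`!)%:R * (k20`!)%:R) *
          (cabs (Fder F k10 k20 z0) / (l1 z0 ^+ k10 * l2 z0 ^+ k20))) ->
  bounded_L_index l1 l2 F.
Proof.
move=> /andP[r10 r1b] /andP[r20 r2b] p1 loc; have p00 : 0 < p0 by lra.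
have b0 := beta_gt0.
have step z0 z : D2 z0 -> polydisc z0 (r1 / l1 z0) (r2 / l2 z0) z -> index_max n0 z <= p0 * index_max n0 z0.
  move=> Dz pz; have [k10 [k20 [kn H]]] := loc _ Dz.
  apply: index_max_le => [|k1 k2 k12]; first by rewrite mulr_ge0 ?index_max_ge0 ?ltW.
  apply: (le_trans (H _ _ _ k12 pz)).
  rewrite [leLHS](_ : _ = p0 * T k10 k20 z0).
    by rewrite ler_pM2l //; exact: Lterm_le_index_max.
  rewrite /Lterm; field; rewrite !pnatr_eq0 -!lt0n !fact_gt0 !expf_neq0 //.
    by rewrite gt_eqF // l1_gt0.
  by rewrite gt_eqF // l2_gt0.
have [La La1 hLa] := weight_comparable.
have La0 : 0 < La by lra.
pose r := Num.min r1 r2.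
have r0 : 0 < r by rewrite lt_min r10.
(* The segment from z0 to z will be cut into m + 1 equal legs. Each is at most beta / ((m + 1)
   l_j(z0)) long in coordinate j, which is within r_j / l_j(w i) because l_j(w i) <= La l_j(z0). *)
have [m hm] : exists m : nat, beta * La <= r * m.+1%:R.
  exists (Num.bound (beta * La / r)).
  have := archi_boundP (ltW (divr_gt0 (mulr_gt0 b0 La0) r0)).
  rewrite ltr_pdivrMr // => h; apply: (le_trans (ltW h)).
  by rewrite mulrC ler_pM2l // ler_nat.
have hm1 : beta * La <= r1 * m.+1%:R.
  by apply: (le_trans hm); rewrite ler_wpM2r // ge_min lexx.
have hm2 : beta * La <= r2 * m.+1%:R.
  by apply: (le_trans hm); rewrite ler_wpM2r // ge_min lexx orbT.
pose P := p0 ^+ m.+1.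
have P0 : 0 < P by rewrite exprn_gt0.
have large z0 z : D2 z0 -> nbhd z0 z -> index_max n0 z <= P * index_max n0 z0.
  move=> Dz nz.
  pose w i : C * C := (z0.1 + rC (i%:R / m.+1%:R) * (z.1 - z0.1), z0.2 + rC (i%:R / m.+1%:R) * (z.2 - z0.2)).
  have m0 : 0 < m.+1%:R :> R by rewrite ltr0n.
  have nw i : (i <= m.+1)%N -> nbhd z0 (w i).
    move=> im; have [n1 n2] := nz; split.
      rewrite /w /= addrAC subrr add0r cabsM cabs_rC ger0_norm ?divr_ge0 //.
      by apply: le_trans n1; rewrite ler_piMl ?cabs_ge0 // ler_pdivrMr // mul1r ler_nat.
    rewrite /w /= addrAC subrr add0r cabsM cabs_rC ger0_norm ?divr_ge0 //.
    by apply: le_trans n2; rewrite ler_piMl ?cabs_ge0 // ler_pdivrMr // mul1r ler_nat.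
  have chain i : (i <= m.+1)%N -> index_max n0 (w i) <= p0 ^+ i * index_max n0 z0.
    elim: i => [|i IH] im.
      rewrite expr0 mul1r (_ : w 0%N = z0) // /w mul0r !mul0r !addr0.
      by rewrite -surjective_pairing.
    have ni := nw i (ltnW im); have Dw := nbhd_D2 Dz ni.
    have [g1 _ g2 _] := hLa _ _ Dz ni; have [n1 n2] := nz.
    rewrite exprS -mulrA; apply: le_trans (_ : p0 * index_max n0 (w i) <= _); last first.
      by rewrite ler_pM2l // IH // ltnW.
    have leg (c z' : C) : z' + rC (i.+1%:R / m.+1%:R) * c - (z' + rC (i%:R / m.+1%:R) * c) = rC (m.+1%:R^-1) * c.
      by rewrite -natr1 mulrDl rCD mul1r; ring.
    have cm : cabs (rC (m.+1%:R^-1 : R)) = m.+1%:R^-1 by rewrite cabs_rC gtr0_norm ?invr_gt0.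
    apply: step => //; split; rewrite /= leg cabsM cm mulrC ler_pdivrMr //.
      apply: (le_trans n1); rewrite mulrAC ler_pdivlMr ?l1_gt0 // mulrAC ler_pdivrMr ?l1_gt0 //.
      apply: le_trans (_ : beta * La * l1 z0 <= _).
        by rewrite -mulrA ler_pM2l.
      by rewrite ler_pM2r ?l1_gt0.
    apply: (le_trans n2); rewrite mulrAC ler_pdivlMr ?l2_gt0 // mulrAC ler_pdivrMr ?l2_gt0 //.
    apply: le_trans (_ : beta * La * l2 z0 <= _).
      by rewrite -mulrA ler_pM2l.
    by rewrite ler_pM2r ?l2_gt0.
  have := chain m.+1 (leqnn _); rewrite (_ : w m.+1 = z) // /w divff ?gt_eqF //.
  by rewrite rC1 !mul1r !(addrC _ (_ - _)) !subrK -surjective_pairing.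
(* From order n1 on, Cauchy's gain beta^(p+q) outweighs the loss P = p0^(m+1) of the chain; orders
   up to max(n0, n1) lie in the maximum anyway. *)
have [n1 hn1] := exists_exp_ge P beta1.
exists (maxn n0 n1) => z0 Dz p q; change (T p q z0 <= index_max (maxn n0 n1) z0).
have [pq|pq] := leqP (p + q) (maxn n0 n1); first exact: Lterm_le_index_max.
apply: le_trans (index_max_mono _ (leq_maxl n0 n1)).
have L1 := l1_gt0 Dz; have L2 := l2_gt0 Dz.
have Cy : cabs (Fder F p q z0) / ((p`!)%:R * (q`!)%:R) * ((beta / l1 z0) ^+ p * (beta / l2 z0) ^+ q) <= P * index_max n0 z0.
  apply: cauchy_ineq2 => //; rewrite ?divr_gt0 ?radius1_lt ?radius2_lt // => z nz.
  apply: le_trans (large _ _ Dz nz); apply: le_trans (@Lterm_le_index_max n0 0 0 z _) => //.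
  by rewrite /Lterm !expr0 !mulr1 divr1.
have E : cabs (Fder F p q z0) / ((p`!)%:R * (q`!)%:R) * ((beta / l1 z0) ^+ p * (beta / l2 z0) ^+ q) = beta ^+ (p + q) * T p q z0.
  rewrite /Lterm exprD !expr_div_n; field.
  by rewrite !pnatr_eq0 -!lt0n !fact_gt0 !expf_neq0 // gt_eqF.
rewrite E in Cy; have bp : 0 < beta ^+ (p + q) by rewrite exprn_gt0.
rewrite -(ler_pM2l bp); apply: (le_trans Cy); rewrite ler_wpM2r ?index_max_ge0 //.
apply: (le_trans hn1); rewrite ler_weXn2l ?ltW //.
by rewrite (leq_trans (leq_maxr n0 n1)) // ltnW.
Qed.

Section Forward.
Variable N : nat.
Hypothesis bN : forall z, D2 z -> forall p q, T p q z <= index_max N z.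
Variable La : R.
Hypothesis La1 : 1 <= La.
Hypothesis hLa : forall z0 z, D2 z0 -> nbhd z0 z ->
  [/\ l1 z <= La * l1 z0, l1 z0 <= La * l1 z, l2 z <= La * l2 z0 & l2 z0 <= La * l2 z].

Local Notation I := ('I_N.+1 * 'I_N.+1)%type.
Definition wt z0 k1 k2 : R := ((k1`!)%:R * (k2`!)%:R * l1 z0 ^+ k1 * l2 z0 ^+ k2)^-1.
(* The sum of the local terms of order at most N with the weights l_j frozen at z0. *)
Definition frozen z0 w : R :=
  \sum_(k : I | (k.1 + k.2 <= N)%N) wt z0 k.1 k.2 * cabs (Fder F k.1 k.2 w).

Lemma wt_gt0 z0 k1 k2 : D2 z0 -> 0 < wt z0 k1 k2.
Proof.
by move=> Dz; rewrite invr_gt0 !mulr_gt0 ?fact_gt0R ?exprn_gt0 ?l1_gt0 ?l2_gt0.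
Qed.

Lemma LtermE k1 k2 z : T k1 k2 z = wt z k1 k2 * cabs (Fder F k1 k2 z).
Proof. by rewrite mulrC. Qed.

(** Each weight factor costs one La, so order k costs La^k; as La >= 1, the exponent N + 1 serves
    every order up to N + 1, including the one reached by differentiating. *)
Lemma wt_comparable z0 z k1 k2 : D2 z0 -> nbhd z0 z -> (k1 + k2 <= N.+1)%N ->
  wt z0 k1 k2 <= La ^+ N.+1 * wt z k1 k2 /\ wt z k1 k2 <= La ^+ N.+1 * wt z0 k1 k2.
Proof.
move=> Dz nz kN; have Dz' := nbhd_D2 Dz nz; have [h1 h2 h3 h4] := hLa Dz nz.
have La0 : 0 < La by exact: lt_le_trans La1.
have gen (a b c d : R) : 0 < a -> 0 < b -> 0 < c -> 0 < d -> a <= La * b -> c <= La * d ->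
    ((k1`!)%:R * (k2`!)%:R * b ^+ k1 * d ^+ k2)^-1 <= La ^+ N.+1 * ((k1`!)%:R * (k2`!)%:R * a ^+ k1 * c ^+ k2)^-1.
  move=> a0 b0 c0 d0 ab cd.
  have f1 := fact_gt0R k1; have f2 := fact_gt0R k2.
  have D1 : 0 < (k1`!)%:R * (k2`!)%:R * b ^+ k1 * d ^+ k2 by rewrite !mulr_gt0 ?exprn_gt0.
  have D2' : 0 < (k1`!)%:R * (k2`!)%:R * a ^+ k1 * c ^+ k2 by rewrite !mulr_gt0 ?exprn_gt0.
  rewrite ler_pdivlMr // mulrC ler_pdivrMr //.
  apply: (@le_trans _ _ (La ^+ (k1 + k2) * ((k1`!)%:R * (k2`!)%:R * b ^+ k1 * d ^+ k2))); last first.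
    by rewrite ler_pM2r // ler_weXn2l.
  rewrite [leRHS](_ : _ = (k1`!)%:R * (k2`!)%:R * (La * b) ^+ k1 * (La * d) ^+ k2); last first.
    by rewrite exprD !exprMn; ring.
  rewrite !ler_pM ?mulr_ge0 ?exprn_ge0 ?ler0n ?(ltW a0) ?(ltW c0) //.
    by rewrite lerXn2r ?nnegrE ?mulr_ge0 ?(ltW a0) ?(ltW La0) ?(ltW b0).
  by rewrite lerXn2r ?nnegrE ?mulr_ge0 ?(ltW c0) ?(ltW La0) ?(ltW d0).
by split; apply: gen; rewrite ?l1_gt0 ?l2_gt0.
Qed.

Lemma term_frozen z0 w (k1 k2 : nat) : D2 z0 -> (k1 + k2 <= N)%N ->
  wt z0 k1 k2 * cabs (Fder F k1 k2 w) <= frozen z0 w.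
Proof.
move=> Dz kN; have k1n : (k1 < N.+1)%N by lia.
have k2n : (k2 < N.+1)%N by lia.
rewrite /frozen (bigD1 (Ordinal k1n, Ordinal k2n)) //= lerDl.
by apply: sumr_ge0 => k _; rewrite mulr_ge0 ?cabs_ge0 // ltW // wt_gt0.
Qed.

Lemma frozen_ge0 z0 w : D2 z0 -> 0 <= frozen z0 w.
Proof. by move=> Dz; apply: sumr_ge0 => k _; rewrite mulr_ge0 ?cabs_ge0 // ltW // wt_gt0. Qed.

Lemma frozen_next z0 w k1 k2 : D2 z0 -> nbhd z0 w -> (k1 + k2 <= N.+1)%N ->
  wt z0 k1 k2 * cabs (Fder F k1 k2 w) <= La ^+ N.+1 * La ^+ N.+1 * frozen z0 w.
Proof.
move=> Dz nw kN; have Dw := nbhd_D2 Dz nw.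
have LaN : 0 <= La ^+ N.+1 by rewrite exprn_ge0 // (le_trans ler01).
have [h _] := wt_comparable Dz nw kN.
apply: (@le_trans _ _ (La ^+ N.+1 * index_max N w)).
  apply: (@le_trans _ _ (La ^+ N.+1 * wt w k1 k2 * cabs (Fder F k1 k2 w))).
    by rewrite ler_wpM2r ?cabs_ge0.
  by rewrite -mulrA -LtermE ler_wpM2l //; exact: bN.
rewrite -mulrA ler_wpM2l //; apply: index_max_le; first by rewrite mulr_ge0 // frozen_ge0.
move=> j1 j2 jN; rewrite LtermE.
have [_ h'] := wt_comparable Dz nw (leqW jN).
apply: (@le_trans _ _ (La ^+ N.+1 * wt z0 j1 j2 * cabs (Fder F j1 j2 w))).
  by rewrite ler_wpM2r ?cabs_ge0.
by rewrite -mulrA ler_wpM2l //; exact: term_frozen.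
Qed.

Definition growth : R := N.+1%:R * (La ^+ N.+1 * La ^+ N.+1).

Lemma frozen_next1 z0 w k1 k2 : D2 z0 -> nbhd z0 w -> (k1 + k2 <= N)%N ->
  wt z0 k1 k2 * cabs (Fder F k1.+1 k2 w) <= growth * l1 z0 * frozen z0 w.
Proof.
move=> Dz nw kN; have L1 := l1_gt0 Dz; have L2 := l2_gt0 Dz.
have E : wt z0 k1 k2 = k1.+1%:R * l1 z0 * wt z0 k1.+1 k2.
  rewrite /wt factS natrM exprS; field.
  by rewrite nat1r !pnatr_eq0 -!lt0n !fact_gt0 !expf_neq0 // gt_eqF.
have kN' : (k1.+1 + k2 <= N.+1)%N by rewrite addSn ltnS.
have := frozen_next Dz nw kN'.
set X := wt z0 k1.+1 k2 * _ => hX.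
rewrite E -mulrA -/X (_ : growth * _ * _ = N.+1%:R * l1 z0 * (La ^+ N.+1 * La ^+ N.+1 * frozen z0 w)); last by rewrite /growth; ring.
rewrite ler_pM ?mulr_ge0 ?ler0n ?(ltW L1) ?cabs_ge0 // ?(ltW (wt_gt0 _ _ Dz)) //.
by rewrite ler_pM2r // ler_nat; lia.
Qed.

Lemma frozen_next2 z0 w k1 k2 : D2 z0 -> nbhd z0 w -> (k1 + k2 <= N)%N ->
  wt z0 k1 k2 * cabs (Fder F k1 k2.+1 w) <= growth * l2 z0 * frozen z0 w.
Proof.
move=> Dz nw kN; have L1 := l1_gt0 Dz; have L2 := l2_gt0 Dz.
have E : wt z0 k1 k2 = k2.+1%:R * l2 z0 * wt z0 k1 k2.+1.
  rewrite /wt factS natrM exprS; field.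
  by rewrite nat1r !pnatr_eq0 -!lt0n !fact_gt0 !expf_neq0 // gt_eqF.
have kN' : (k1 + k2.+1 <= N.+1)%N by rewrite addnS ltnS.
have := frozen_next Dz nw kN'.
set X := wt z0 k1 k2.+1 * _ => hX.
rewrite E -mulrA -/X (_ : growth * _ * _ = N.+1%:R * l2 z0 * (La ^+ N.+1 * La ^+ N.+1 * frozen z0 w)); last by rewrite /growth; ring.
rewrite ler_pM ?mulr_ge0 ?ler0n ?(ltW L2) ?cabs_ge0 // ?(ltW (wt_gt0 _ _ Dz)) //.
by rewrite ler_pM2r // ler_nat; lia.
Qed.

(** There are (N + 1)^2 index pairs, so this makes their number times [growth] times the radius at
    most 1/2, as [segment_doubling] requires. The leading 1 keeps the radius below 1, hence below
    beta. *)
Definition small_radius : R := (1 + 2 * (N.+1 * N.+1)%:R * growth)^-1.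

Lemma growth_gt0 : 0 < growth.
Proof. by rewrite !mulr_gt0 ?ltr0n ?exprn_gt0 // (lt_le_trans ltr01). Qed.

Lemma small_radius_den : 0 < 1 + 2 * (N.+1 * N.+1)%:R * growth.
Proof.
apply: addr_gt0 => //; apply: mulr_gt0; last exact: growth_gt0.
by rewrite mulr_gt0 ?ltr0n.
Qed.

Lemma small_radius_gt0 : 0 < small_radius.
Proof. by rewrite invr_gt0 small_radius_den. Qed.

Lemma small_radius_le : small_radius <= beta.
Proof.
apply: le_trans (ltW beta1); rewrite invf_le1 ?small_radius_den // lerDl.
by rewrite (mulr_ge0 _ (ltW growth_gt0)) // mulr_ge0 ?ler0n.
Qed.

Lemma small_radiusP (l d : R) : 0 < l -> d <= small_radius / l ->
  #|{: I}|%:R * (growth * l * d) <= 1 / 2.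
Proof.
move=> l0; rewrite card_prod !card_ord ler_pdivlMr // => hd.
have G0 := growth_gt0.
have hs : 2 * (N.+1 * N.+1)%:R * growth * small_radius <= 1.
  by rewrite ler_pdivrMr ?small_radius_den // mul1r lerDr.
have : (N.+1 * N.+1)%:R * growth * (d * l) <= (N.+1 * N.+1)%:R * growth * small_radius.
  by rewrite ler_pM2l // mulr_gt0 ?ltr0n.
lra.
Qed.

Lemma frozen_growth z0 z : D2 z0 ->
  polydisc z0 (small_radius / l1 z0) (small_radius / l2 z0) z ->
  frozen z0 z <= 4 * frozen z0 z0.
Proof.
move=> Dz [p1 p2]; have L1 := l1_gt0 Dz; have L2 := l2_gt0 Dz.
have s0 := small_radius_gt0; have sb := small_radius_le.
have G0 := growth_gt0.
have seg (a b : C) (t s : R) : 0 <= t <= 1 -> cabs (b - a) <= s -> cabs (a + rC t * (b - a) - a) <= s.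
  move=> /andP[t0 t1]; apply: le_trans.
  by rewrite addrAC subrr add0r cabsM cabs_rC ger0_norm // ler_piMl ?cabs_ge0.
have nb (w1 w2 : C) : cabs (w1 - z0.1) <= small_radius / l1 z0 -> cabs (w2 - z0.2) <= small_radius / l2 z0 -> nbhd z0 (w1, w2).
  by move=> h1 h2; apply: (@nbhd_sub z0 _ small_radius small_radius).
have leg1 : frozen z0 (z.1, z0.2) <= 2 * frozen z0 (z0.1, z0.2).
  apply: (@segment_doubling R I (fun k => k.1 + k.2 <= N)%N (fun k v => Fder F k.1 k.2 (v, z0.2))
    (fun k v => Fder F k.1.+1 k.2 (v, z0.2)) (fun k => wt z0 k.1 k.2) z0.1 z.1 (growth * l1 z0)).
  - by move=> k; exact: wt_gt0.
  - move=> k t t01; apply: (@Fder_cderiv1 _ F k.1 k.2 (_, z0.2) aF).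
    by apply: (nbhd_D2 Dz); apply: nb; [exact: seg|rewrite subrr cabs0 divr_ge0 // ltW].
  - move=> k t kN t01; apply: frozen_next1 => //.
    by apply: nb; [exact: seg|rewrite subrr cabs0 divr_ge0 // ltW].
  - by rewrite mulr_ge0 // ltW.
  - exact: small_radiusP.
have leg2 : frozen z0 (z.1, z.2) <= 2 * frozen z0 (z.1, z0.2).
  apply: (@segment_doubling R I (fun k => k.1 + k.2 <= N)%N (fun k v => Fder F k.1 k.2 (z.1, v))
    (fun k v => Fder F k.1 k.2.+1 (z.1, v)) (fun k => wt z0 k.1 k.2) z0.2 z.2 (growth * l2 z0)).
  - by move=> k; exact: wt_gt0.
  - move=> k t t01; apply: (@Fder_cderiv2 _ F k.1 k.2 (z.1, _) aF).
    by apply: (nbhd_D2 Dz); apply: nb => //; exact: seg.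
  - move=> k t kN t01; apply: frozen_next2 => //.
    by apply: nb => //; exact: seg.
  - by rewrite mulr_ge0 // ltW.
  - exact: small_radiusP.
move: leg1 leg2; rewrite -!surjective_pairing; lra.
Qed.

(** The witness (k10, k20) is the index of the largest term at z0. In the constant, La^(N+1)
    unfreezes the weights at z, 4 is one doubling per coordinate, (N + 1)^2 bounds the sum at z0 by
    its largest term, and the added 1 makes it exceed 1. *)
Lemma local_of_bounded_index :
  [/\ 0 < small_radius <= beta, 0 < small_radius <= beta &
      1 < 1 + 4 * La ^+ N.+1 * (N.+1 * N.+1)%:R] /\
    forall z0, D2 z0 ->
      exists k10 k20 : nat, (k10 + k20 <= N)%N /\
        forall (k1 k2 : nat) z, (k1 + k2 <= N)%N ->
          polydisc z0 (small_radius / l1 z0) (small_radius / l2 z0) z ->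
          T k1 k2 z <=
          (1 + 4 * La ^+ N.+1 * (N.+1 * N.+1)%:R) / ((k10`!)%:R * (k20`!)%:R) *
          (cabs (Fder F k10 k20 z0) / (l1 z0 ^+ k10 * l2 z0 ^+ k20)).
Proof.
have LaN : 0 < La ^+ N.+1 by rewrite exprn_gt0 // (lt_le_trans ltr01).
split; first by rewrite small_radius_gt0 small_radius_le ltrDl !mulr_gt0 // ltr0n.
move=> z0 Dz.
pose i0 : I := (ord0, ord0).
have Pi0 : (i0.1 + i0.2 <= N)%N by [].
have [[j1 j2] jN jmax] := @arg_maxP _ _ I i0 (fun k => k.1 + k.2 <= N)%N (fun k => T k.1 k.2 z0) Pi0.
exists j1, j2; split => // k1 k2 z kN pz.
have nz : nbhd z0 z := nbhd_sub Dz small_radius_le small_radius_le pz.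
have Tj0 : 0 <= T j1 j2 z0 by exact: Lterm_ge0.
have S0 : frozen z0 z0 <= (N.+1 * N.+1)%:R * T j1 j2 z0.
  apply: (@le_trans _ _ (\sum_(k : I) T j1 j2 z0)); last first.
    by rewrite sumr_const card_prod !card_ord mulr_natl.
  rewrite /frozen big_mkcond /=; apply: ler_sum => k _; case: ifP => // kN'.
  by rewrite -LtermE; exact: jmax.
rewrite [leRHS](_ : _ = (1 + 4 * La ^+ N.+1 * (N.+1 * N.+1)%:R) * T j1 j2 z0); last first.
  rewrite /Lterm; field; rewrite !pnatr_eq0 -!lt0n !fact_gt0 !expf_neq0 //.
    by rewrite gt_eqF // l1_gt0.
  by rewrite gt_eqF // l2_gt0.
rewrite LtermE; have [_ h] := wt_comparable Dz nz (leqW kN).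
have := ler_wpM2r (cabs_ge0 (Fder F k1 k2 z)) h; rewrite -mulrA => h1.
have h2 := ler_wpM2l (ltW LaN) (term_frozen z Dz kN).
have h3 := ler_wpM2l (ltW LaN) (frozen_growth Dz pz).
have h4 := ler_wpM2l (ltW LaN) S0.
lra.
Qed.

End Forward.

End Index.

Unset Implicit Arguments. Set Strict Implicit. Set Printing Implicit Defensive.

Theorem theorem4 (R : realType) (beta : R) (l1 l2 : CC R * CC R -> R)
  (F : CC R * CC R -> CC R) :
  1 < beta ->
  {within D2 (R:=R), continuous l1} ->
  {within D2 (R:=R), continuous l2} ->
  (forall z, D2 z -> 0 <= l1 z /\ 0 <= l2 z) ->
  (forall z, D2 z -> beta / (1 - cabs z.1) < l1 z) ->
  (forall z, D2 z -> beta / (1 - cabs z.2) < l2 z) ->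
  Q2 beta l1 l2 ->
  analytic_D2 F ->
  bounded_L_index l1 l2 F <->
  exists (r1 r2 : R) (n0 : nat) (p0 : R),
    [/\ 0 < r1 <= beta, 0 < r2 <= beta & 1 < p0] /\
    forall z0, D2 z0 ->
      exists k10 k20 : nat, (k10 + k20 <= n0)%N /\
        forall (k1 k2 : nat) z, (k1 + k2 <= n0)%N ->
          polydisc z0 (r1 / l1 z0) (r2 / l2 z0) z ->
          Lterm l1 l2 F k1 k2 z <=
          p0 / ((k10`!)%:R * (k20`!)%:R) *
          (cabs (Fder F k10 k20 z0) / (l1 z0 ^+ k10 * l2 z0 ^+ k20)).
Proof.
move=> beta1 _ _ _ hl1 hl2 hQ aF; split.
  move=> [N bN]; have [La La1 hLa] := weight_comparable beta1 hl1 hl2 hQ.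
  by do 4 eexists; exact: (local_of_bounded_index beta1 hl1 hl2 aF bN La1 hLa).
move=> [r1 [r2 [n0 [p0 [[h1 h2 h3] H]]]]].
exact: (bounded_index_of_local beta1 hl1 hl2 hQ aF h1 h2 h3 H).
Qed.
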